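(* Let $F$ be a field of characteristic zero and let $1\leq k\leq n$ be integers. Then for every $r=1,\dots,k$ the system of linear equations $$\sum_{j=0}^r(-1)^j\binom{n-j}{l-j}x_{j,r}=0\quad (l=k,k-1,\dots,k-r+1),\qquad \sum_{j=0}^r(-1)^j\binom{n-j}{k-r-j}x_{j,r}=1$$ has a solution $\mathbf{x}_r=(x_{0,r},\dots,x_{r,r})$ in $F$, so that the corresponding map $\phi_r:\mathcal{O}(n-k)\to\mathcal{P}^k(\mathcal{O}(n))$ of left $\mathcal{O}_{\mathbf{P}^1}$-modules on $\mathbf{P}^1_F$ (defined in the context) exists, and the induced map $\phi=\oplus_{i=0}^k\phi_i$ is an isomorphism $$\oplus_{i=0}^k\mathcal{O}(n-k)\;\cong\;\mathcal{P}^k(\mathcal{O}(n))$$ of left $\mathcal{O}_{\mathbf{P}^1}$-modules.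
   Context: Let $X=\mathbf{P}^1_F=\operatorname{Proj}F[x_0,x_1]$, let $p,q:X\times_F X\to X$ be the first and second projections, let $\mathcal{I}$ be the ideal sheaf of the diagonal, and $\mathcal{O}_{\Delta^k}=\mathcal{O}_{X\times X}/\mathcal{I}^{k+1}$. Then $\mathcal{P}^k(\mathcal{O}(n))=p_*(\mathcal{O}_{\Delta^k}\otimes q^*\mathcal{O}(n))$, and its left $\mathcal{O}_X$-module structure is the one as a push-forward along $p$. Put $U_i=D(x_i)$ for $i=0,1$ and $U_{01}=U_0\cap U_1$. Let $t=x_1/x_0$ be the coordinate on the first factor and $u$ the same coordinate on the second factor, so that on $U_{01}$ one has $x_1^m=t^mx_0^m$ in $\mathcal{O}(m)$, $\mathcal{O}_{\Delta^k}$ corresponds to $F[t,\frac1t,u,\frac1u]/(u-t,\frac1u-\frac1t)^{k+1}$, and left multiplication is multiplication by functions of $t$. Write $dt^i=(u-t)^i$ and $ds^i=(\frac1u-\frac1t)^i$. As left module, $\mathcal{P}^k(\mathcal{O}(n))$ is free on $U_0$ over $F[t]$ with basis $dt^i\otimes x_0^n$, $0\le i\le k$, and free on $U_1$ over $F[\frac1t]$ with basis $ds^i\otimes x_1^n$, $0\le i\le k$ (with $dt^0=ds^0=1$). The sheaf $\mathcal{O}(n-k)$ is free on $U_i$ with basis $x_i^{n-k}$. Convention: $\binom{a}{b}=0$ for $b<0$. Maps: for a solution $\mathbf{x}_r=(x_{0,r},\dots,x_{r,r})$ in $F$ of the system of linear equations $\sum_{j=0}^r(-1)^j\binom{n-j}{l-j}x_{j,r}=0$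 for $l=k,k-1,\dots,k-r+1$ and $\sum_{j=0}^r(-1)^j\binom{n-j}{k-r-j}x_{j,r}=1$ ($1\le r\le k$), $\phi_r:\mathcal{O}(n-k)\to\mathcal{P}^k(\mathcal{O}(n))$ is the map of left $\mathcal{O}_X$-modules given on $U_0$ by $\phi_r(x_0^{n-k})=\sum_{l=0}^{k-r}c^r_l\,t^{k-r-l}\,dt^l\otimes x_0^n$, with $c^r_l=\sum_{j=0}^r(-1)^j\binom{n-j}{l-j}x_{j,r}$, and on $U_1$ by $\phi_r(x_1^{n-k})=\sum_{j=0}^r x_{j,r}\,t^{j-r}\,ds^j\otimes x_1^n$. The map $\phi_0$ is given by $\phi_0(x_0^{n-k})=\sum_{l=0}^k\binom{n}{l}t^{k-l}dt^l\otimes x_0^n$ on $U_0$ and $\phi_0(x_1^{n-k})=1\otimes x_1^n$ on $U_1$. *)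

(* Defs.v *)
From HB Require Import structures.
From mathcomp Require Import all_boot all_algebra.
From mathcomp Require Import boolp classical_sets functions.

Set Implicit Arguments.
Unset Strict Implicit.
Unset Printing Implicit Defensive.

Import GRing.Theory.
Local Open Scope classical_set_scope.
Local Open Scope ring_scope.
Local Open Scope quotient_scope.

Definition subring_set (E : fieldType) (A : set E) : Prop :=
  [/\ A 1, forall x y, A x -> A y -> A (x - y)
     & forall x y, A x -> A y -> A (x * y)].

(** An integral separated scheme with function field [E] is represented by the
    set of its local rings, seen as subsets of [E]: a point is identified with
    its local ring, and [spec ev] is the affine scheme Spec R.  The inclusions
    between local rings encode the gluing of affine charts. *)

(* The localization of R at the prime p, where ev embeds R in E. *)
Definition local_ring (R : comNzRingType) (E : fieldType) (ev : R -> E)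
    (p : {pred R}) : set E :=
  [set z | exists f g : R, g \notin p /\ z = ev f / ev g].

Definition spec (R : comNzRingType) (E : fieldType) (ev : R -> E) :
    set (set E) :=
  [set A | exists p : prime_idealr R, A = local_ring ev p].

(* The Zariski topology is generated by the domains of definition
   {P | f \in O_P} of the elements f of the function field. *)
Definition zariski_nbhd (E : fieldType) (X : set (set E)) (P : set E)
    (U : set (set E)) : Prop :=
  exists s : seq E, (forall f, f \in s -> P f) /\
    forall P', X P' -> (forall f, f \in s -> P' f) -> U P'.

Definition zariski_open (E : fieldType) (X U : set (set E)) : Prop :=
  U `<=` X /\ forall P, U P -> zariski_nbhd X P U.

(* The A-submodule generated by G. *)
Definition mspan (E : fieldType) (A G : set E) : set E :=
  [set z | exists s : seq (E * E),
     (forall x, x \in s -> A x.1 /\ G x.2) /\ z = \sum_(x <- s) x.1 * x.2].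

Lemma local_ring_subring (R : idomainType) (E : fieldType)
  (ev : {rmorphism R -> E}) (p : prime_idealr R) :
  injective ev -> subring_set (local_ring ev p).
Proof.
move=> inj.
have nz g : g \notin p -> ev g != 0.
  by move=> pg; rewrite raddf_eq0 //; apply: contraNneq pg => ->; apply: rpred0.
have pM f g : f \notin p -> g \notin p -> f * g \notin p.
  by move=> pf pg; rewrite prime_idealrM negb_or pf.
split=> [|_ _ [f [g [pg ->]]] [f' [g' [pg' ->]]]|
          _ _ [f [g [pg ->]]] [f' [g' [pg' ->]]]].
- exists 1, 1; rewrite rmorph1 divr1; split=> //.
  by rewrite idealr1.
- exists (f * g' - f' * g), (g * g'); split; first exact: pM.
  rewrite -mulNr addf_div ?nz // mulNr.
  by rewrite !(rmorphB, rmorphM).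
- exists (f * f'), (g * g'); split; first exact: pM.
  by rewrite mulf_div !rmorphM.
Qed.

Section Span.
Variables (E : fieldType) (A G : set E).
Hypothesis A_subring : subring_set A.

Lemma span0 : mspan A G 0.
Proof. by exists [::]; rewrite big_nil. Qed.

Lemma span_gen z : G z -> mspan A G z.
Proof.
have [A1 _ _] := A_subring.
move=> Gz; exists [:: (1, z)]; split; last by rewrite big_seq1 mul1r.
by move=> x; rewrite inE => /eqP ->.
Qed.

Lemma spanM a z : A a -> mspan A G z -> mspan A G (a * z).
Proof.
have [_ _ AM] := A_subring.
move=> Aa [s [sAG ->]]; exists [seq (a * x.1, x.2) | x <- s]; split.
  by move=> _ /mapP[x /sAG[Ax Gx] ->]; split=> //; apply: AM.
by rewrite big_map mulr_sumr; apply: eq_bigr => x _; rewrite mulrA.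
Qed.

Lemma spanB y z : mspan A G y -> mspan A G z -> mspan A G (y - z).
Proof.
have [A1 AB _] := A_subring.
have A0 : A 0 by rewrite -(subrr 1); apply: AB.
have AN x : A x -> A (- x) by rewrite -sub0r; apply: AB.
move=> Sy /(spanM (AN _ A1)); rewrite mulN1r.
case: Sy => [r [rAG ->]] [s [sAG ->]]; exists (r ++ s); rewrite big_cat.
by split=> // x; rewrite mem_cat => /orP[/rAG|/sAG].
Qed.

End Span.

Definition evp (R : comNzRingType) (E : fieldType) (c : R -> E) (a : E)
  (f : {poly R}) : E := (map_poly c f).[a].

HB.instance Definition _ (R : comNzRingType) (E : fieldType)
    (c : {rmorphism R -> E}) (a : E) :=
  GRing.RMorphism.copy (evp c a) (horner_eval a \o map_poly c).

Lemma evpE (R : comNzRingType) (E : fieldType) (c : {rmorphism R -> E})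
  (a : E) (p : {poly R}) m : (size p <= m)%N ->
  evp c a p = \sum_(i < m) c p`_i * a ^+ i.
Proof.
move=> lepm; rewrite /evp (@horner_coef_wide _ m).
  by apply: eq_bigr => i _; rewrite coef_map.
by apply: leq_trans lepm; rewrite /map_poly size_poly.
Qed.

Lemma evp_inv_inj (R : idomainType) (E : fieldType) (c : {rmorphism R -> E})
  (a : E) : a != 0 -> injective (evp c a) -> injective (evp c a^-1).
Proof.
move=> a0 inja; apply: raddf_inj => p pa0.
suff rp0 : Poly (rev p) = 0.
  apply/polyP => i; rewrite coef0.
  have [lt_ip|/(nth_default 0)//] := ltnP i (size p).
  by rewrite -[polyseq p]revK nth_rev ?size_rev // -coef_Poly rp0 coef0.
apply: inja; rewrite raddf0 (@evpE _ _ _ _ _ (size p)); last first.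
  by rewrite (leq_trans (size_Poly _)) // size_rev.
have pE : 0 = _ := etrans (esym pa0) (evpE c a^-1 (leqnn (size p))).
rewrite -[RHS](mulr0 (a ^+ (size p).-1)) [X in _ = _ * X]pE mulr_sumr.
rewrite [RHS](reindex_inj rev_ord_inj); apply: eq_bigr => i _ /=.
rewrite coef_Poly nth_rev // mulrCA; congr (_ * _).
have -> : (size p).-1 = (i + (size p - i.+1))%N.
  by case: (size p) i => [|m] [l lt_lm] //=; rewrite subSS subnKC.
by rewrite exprD exprVn mulfK // expf_neq0.
Qed.

Lemma evp_swap (R : comNzRingType) (E : fieldType) (c : {rmorphism R -> E})
  (a b : E) f : evp (evp c a) b f = evp (evp c b) a (swapXY f).
Proof.
have ev2E x y (g : {poly {poly R}}) :
    evp (evp c x) y g = (map_poly (map_poly c) g).[y%:P].[x].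
  rewrite /evp -[in RHS]horner_evalE -horner_map /= -map_poly_comp.
  by rewrite /= horner_evalE hornerC.
by rewrite !ev2E -swapXY_map horner2_swapXY.
Qed.

Section ProjectiveLine.
Variable F : fieldType.

(** The function fields F(t) of P^1 and F(t, u) of P^1 x P^1; in
    [{poly {poly F}}] the inner variable is t and the outer one is u. *)
Definition K1 : fieldType := {fraction {poly F}}.
Definition K2 : fieldType := {fraction {poly {poly F}}}.

Definition c1 (c : F) : K1 := FracField.tofrac c%:P.
Definition c2 (c : F) : K2 := FracField.tofrac c%:P%:P.
HB.instance Definition _ := GRing.RMorphism.copy c1
  (@FracField.tofrac _ \o polyC).
HB.instance Definition _ := GRing.RMorphism.copy c2
  (@FracField.tofrac _ \o polyC \o polyC).
Definition t1 : K1 := FracField.tofrac 'X.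
Definition t2 : K2 := FracField.tofrac 'X%:P.
Definition u2 : K2 := FracField.tofrac 'X.

(* P^1 is covered by Spec F[t] and Spec F[1/t]. *)
Definition ev1 (a : K1) : {poly F} -> K1 := evp c1 a.
Definition P1 : set (set K1) := spec (ev1 t1) `|` spec (ev1 t1^-1).

(* P^1 x P^1 is covered by the spectra of F[t,u], F[t,1/u], F[1/t,u] and
   F[1/t,1/u]. *)
Definition ev2 (a b : K2) : {poly {poly F}} -> K2 := evp (evp c2 a) b.
Definition P1xP1 : set (set K2) :=
  (spec (ev2 t2 u2) `|` spec (ev2 t2 u2^-1)) `|`
  (spec (ev2 t2^-1 u2) `|` spec (ev2 t2^-1 u2^-1)).

(** The comorphisms z(t) |-> z(t) and z(t) |-> z(u) of the two projections. *)
Definition frac_lift (h : {poly F} -> K2) (z : K1) : K2 :=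
  h \n_(repr z) / h \d_(repr z).
Definition pullp : K1 -> K2 := frac_lift (evp c2 t2).
Definition pullq : K1 -> K2 := frac_lift (evp c2 u2).

Definition projp (Q : set K2) : set K1 := [set z | Q (pullp z)].
Definition projq (Q : set K2) : set K1 := [set z | Q (pullq z)].

Section LiftMorphism.
Variable h : {rmorphism {poly F} -> K2}.
Hypothesis h_inj : injective h.

Let h_neq0 f : f != 0 -> h f != 0.
Proof. by rewrite -(inj_eq h_inj) rmorph0. Qed.

Let fracE (z : K1) :
  z = FracField.tofrac \n_(repr z) / FracField.tofrac \d_(repr z).
Proof.
rewrite -[LHS]reprK -[repr z in LHS]Ratio_numden.
move: (\n_(repr z)) (\d_(repr z)) (denom_ratioP (repr z)) => n d d0.
apply: (canRL (mulfK _)); first by rewrite tofrac_eq0.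
unlock FracField.tofrac; rewrite -[LHS]FracField.pi_mul; apply/eqmodP.
by rewrite /= FracField.equivfE /FracField.mulf !numden_Ratio
  ?mulr1 ?oner_neq0 //= mulrC.
Qed.

Lemma frac_lift_frac a b : b != 0 ->
  frac_lift h (FracField.tofrac a / FracField.tofrac b) = h a / h b.
Proof.
move=> b0; rewrite /frac_lift; set z : K1 := _ / _.
have d0 := denom_ratioP (repr z).
have := fracE z; rewrite {1}/z => /eqP.
rewrite eqr_div ?tofrac_eq0 // -!tofracM tofrac_eq => /eqP e.
by apply/eqP; rewrite eqr_div ?h_neq0 // -!rmorphM e.
Qed.

Lemma fracP (z : K1) : exists a b,
  b != 0 /\ z = FracField.tofrac a / FracField.tofrac b.
Proof.
by exists \n_(repr z), \d_(repr z); split; [exact: denom_ratioP|exact: fracE].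
Qed.

Lemma frac_lift1 : frac_lift h 1 = 1.
Proof.
have := @frac_lift_frac 1 1 (oner_neq0 _).
by rewrite !rmorph1 divr1 => ->; rewrite divr1.
Qed.

Lemma frac_liftD y z : frac_lift h (y + z) = frac_lift h y + frac_lift h z.
Proof.
have [a [b [b0 ->]]] := fracP y; have [c [d [d0 ->]]] := fracP z.
rewrite addf_div ?tofrac_eq0 // -!tofracM -tofracD.
rewrite !frac_lift_frac ?mulf_neq0 // addf_div ?h_neq0 //.
by rewrite !(rmorphD, rmorphM).
Qed.

Lemma frac_liftM y z : frac_lift h (y * z) = frac_lift h y * frac_lift h z.
Proof.
have [a [b [b0 ->]]] := fracP y; have [c [d [d0 ->]]] := fracP z.
rewrite mulf_div -!tofracM !frac_lift_frac ?mulf_neq0 // mulf_div.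
by rewrite !rmorphM.
Qed.

End LiftMorphism.

Lemma t1_neq0 : t1 != 0. Proof. by rewrite tofrac_eq0 polyX_eq0. Qed.
Lemma t2_neq0 : t2 != 0.
Proof. by rewrite tofrac_eq0 polyC_eq0 polyX_eq0. Qed.
Lemma u2_neq0 : u2 != 0. Proof. by rewrite tofrac_eq0 polyX_eq0. Qed.

Lemma evp_tofrac (R : idomainType) (f : {poly R}) :
  evp (fun c => FracField.tofrac c%:P) (FracField.tofrac 'X) f =
  FracField.tofrac f :> {fraction {poly R}}.
Proof.
by rewrite /evp map_poly_comp horner_map -/(comp_poly _ _) comp_polyXr.
Qed.

Lemma ev1E f : ev1 t1 f = FracField.tofrac f. Proof. exact: evp_tofrac. Qed.

Lemma evp_t2 f : evp c2 t2 f = FracField.tofrac f%:P.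
Proof.
rewrite /evp (map_poly_comp (@FracField.tofrac _ \o polyC) polyC).
by rewrite (horner_map (@FracField.tofrac _ \o polyC)) -/(comp_poly _ _)
  comp_polyXr.
Qed.

Lemma ev2E f : ev2 t2 u2 f = FracField.tofrac f.
Proof. by rewrite /ev2 /evp (eq_map_poly evp_t2); apply: evp_tofrac. Qed.

Let tofrac_inj (R : idomainType) : injective (@FracField.tofrac R).
Proof. by move=> x y /eqP; rewrite tofrac_eq => /eqP. Qed.

Let swap_inj (a b : K2) :
  injective (ev2 a b) -> injective (ev2 b a).
Proof.
move=> inj f g; rewrite /ev2 !(evp_swap _ b a) => /inj.
exact: (can_inj (@swapXYK _)).
Qed.

Let inv_inj (a b : K2) : b != 0 -> injective (ev2 a b) ->
  injective (ev2 a b^-1).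
Proof. exact: evp_inv_inj. Qed.

Lemma ev1_inj a : a \in [:: t1; t1^-1] -> injective (ev1 a).
Proof.
have inj : injective (ev1 t1) by move=> f g; rewrite !ev1E => /tofrac_inj.
rewrite !inE => /orP[] /eqP -> //.
by apply: evp_inv_inj inj; apply: t1_neq0.
Qed.

Lemma ev2_inj a b : a \in [:: t2; t2^-1] -> b \in [:: u2; u2^-1] ->
  injective (ev2 a b).
Proof.
have inj : injective (ev2 t2 u2) by move=> f g; rewrite !ev2E => /tofrac_inj.
have inj' b' : b' \in [:: u2; u2^-1] -> injective (ev2 t2 b').
  by rewrite !inE => /orP[] /eqP -> //; apply: inv_inj inj; apply: u2_neq0.
move=> ta /inj' injb; move: ta; rewrite !inE => /orP[] /eqP -> //.
by apply/swap_inj/inv_inj; [apply: t2_neq0 | apply: swap_inj].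
Qed.

Lemma P1_subring P : P1 P -> subring_set P.
Proof.
by case=> -[p ->]; apply: local_ring_subring; apply: ev1_inj;
  rewrite !inE eqxx ?orbT.
Qed.

Lemma P1xP1_subring Q : P1xP1 Q -> subring_set Q.
Proof.
by case=> -[] [p ->]; apply: local_ring_subring; apply: ev2_inj;
  rewrite !inE eqxx ?orbT.
Qed.

Let evp_t2_inj : injective (evp c2 t2).
Proof. by move=> f g; rewrite !evp_t2 => /tofrac_inj/polyC_inj. Qed.

Let evp_u2_inj : injective (evp c2 u2).
Proof.
have e f : evp c2 u2 f = ev2 t2 u2 (map_poly polyC f).
  transitivity (map_poly (evp c2 t2) (map_poly polyC f)).[u2] => //.
  rewrite -map_poly_comp; congr (_.[_]); apply: eq_map_poly => c.
  by rewrite /= /evp map_polyC hornerC.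
move=> f g; rewrite !e => /ev2_inj h.
by apply: (map_inj_poly (@polyC_inj F) (polyC0 F)); apply: h;
  rewrite !inE eqxx.
Qed.

Lemma pullp1 : pullp 1 = 1. Proof. exact: frac_lift1. Qed.
Lemma pullpD y z : pullp (y + z) = pullp y + pullp z.
Proof. exact: (frac_liftD evp_t2_inj). Qed.
Lemma pullpM y z : pullp (y * z) = pullp y * pullp z.
Proof. exact: (frac_liftM evp_t2_inj). Qed.

Lemma pullq1 : pullq 1 = 1. Proof. exact: frac_lift1. Qed.
Lemma pullqD y z : pullq (y + z) = pullq y + pullq z.
Proof. exact: (frac_liftD evp_u2_inj). Qed.
Lemma pullqM y z : pullq (y * z) = pullq y * pullq z.
Proof. exact: (frac_liftM evp_u2_inj). Qed.

(* Nonempty open subsets of P^1: since P^1 is irreducible, sections of O and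
   of O(m) over them are elements of the function field.  The empty set
   carries no information (all sections over it are zero). *)
Record opens := Opens {
  opset :> set (set K1);
  opens_open : zariski_open P1 opset;
  opens_neq0 : opset !=set0
}.

Lemma opens_subring (U : opens) P : opset U P -> subring_set P.
Proof. by case: U => U [sUP1 _] ne /= /sUP1; apply: P1_subring. Qed.

(* O(U) is the intersection of the local rings of the points of U. *)
Definition OX_pred (U : opens) : {pred K1} :=
  fun z => `[< forall P, opset U P -> P z >].

Lemma OX_pred_closed U : subring_closed (OX_pred U).
Proof.
split=> [|x y|x y].
- by apply/asboolP => P /opens_subring[].
- move=> /asboolP Ux /asboolP Uy; apply/asboolP => P UP.
  by have [_ PB _] := opens_subring UP; apply: PB; [apply: Ux | apply: Uy].
- move=> /asboolP Ux /asboolP Uy; apply/asboolP => P UP.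
  by have [_ _ PM] := opens_subring UP; apply: PM; [apply: Ux | apply: Uy].
Qed.
HB.instance Definition _ U :=
  GRing.isSubringClosed.Build K1 (OX_pred U) (OX_pred_closed U).

Record OX (U : opens) := MkOX { OX_val : K1; _ : OX_val \in OX_pred U }.
HB.instance Definition _ U := [isSub for @OX_val U].
HB.instance Definition _ U := [Choice of OX U by <:].
HB.instance Definition _ U := [SubChoice_isSubComNzRing of OX U by <:].

Lemma OX_stalk U (a : OX U) P : opset U P -> P (val a).
Proof. by case: a => a /= /asboolP; apply. Qed.

Lemma OX_res_subproof (U V : opens) (sVU : V `<=` U) (a : OX U) :
  val a \in OX_pred V.
Proof. by apply/asboolP => P /sVU; apply: OX_stalk. Qed.
Definition OX_res (U V : opens) (sVU : V `<=` U) (a : OX U) : OX V :=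
  MkOX (OX_res_subproof sVU a).

(* Sheaves of O-modules; sheaf_glue is the sheaf axiom, where compatibility on
   V i `&` V j is expressed on all the nonempty open subsets of it. *)
Record OXmod := MkOXmod {
  sections :> forall U : opens, lmodType (OX U);
  res : forall U V : opens, V `<=` U -> sections U -> sections V;
  res_is_zmod_morphism : forall (U V : opens) (sVU : V `<=` U),
    zmod_morphism (@res U V sVU);
  resZ : forall (U V : opens) (sVU : V `<=` U) (a : OX U) s,
    @res U V sVU (a *: s) = OX_res sVU a *: res sVU s;
  res_id : forall (U : opens) (sUU : U `<=` U) s, @res U U sUU s = s;
  res_comp : forall (U V W : opens) (sVU : V `<=` U) (sWV : W `<=` V)
    (sWU : W `<=` U) s, res sWV (res sVU s) = res sWU s;
  sheaf_glue : forall (U : opens) (I : Type) (V : I -> opens)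
    (sVU : forall i, V i `<=` U) (s : forall i, sections (V i)),
    opset U `<=` \bigcup_i opset (V i) ->
    (forall i j (W : opens) (sWi : W `<=` V i) (sWj : W `<=` V j),
      res sWi (s i) = res sWj (s j)) ->
    exists! s0, forall i, res (sVU i) s0 = s i
}.

Record OXhom (M N : OXmod) := Hom {
  hom_fun :> forall U : opens, {linear M U -> N U};
  hom_res : forall (U V : opens) (sVU : V `<=` U) s,
    hom_fun V (res sVU s) = res sVU (hom_fun U s)
}.

Definition is_OXiso (M N : OXmod) (f : OXhom M N) : Prop :=
  exists g : OXhom N M, forall U, cancel (f U) (g U) /\ cancel (g U) (f U).

Lemma zariski_nbhdI (E : fieldType) (X : set (set E)) P U V :
  zariski_nbhd X P U -> zariski_nbhd X P V -> zariski_nbhd X P (U `&` V).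
Proof.
move=> [r [rP rU]] [s [sP sV]]; exists (r ++ s); split.
  by move=> f; rewrite mem_cat => /orP[/rP|/sP].
move=> P' XP' H; split; [apply: rU | apply: sV] => // f fs; apply: H;
  by rewrite mem_cat fs ?orbT.
Qed.

Lemma zariski_nbhdS (E : fieldType) (X : set (set E)) P (U V : set (set E)) :
  (forall P', X P' -> U P' -> V P') ->
  zariski_nbhd X P U -> zariski_nbhd X P V.
Proof.
move=> sUV [s [sP sU]]; exists s; split=> // P' XP' /(sU _ XP'); exact: sUV.
Qed.

(* The local ring of the generic point is K1 = setT. *)
Definition zero_ideal : {pred {poly F}} := pred1 0.
Lemma zero_ideal_closed : idealr_closed zero_ideal.
Proof.
split; rewrite ?inE ?eqxx ?oner_eq0 // => a x y.
by rewrite !inE => /eqP -> /eqP ->; rewrite mulr0 addr0.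
Qed.
HB.instance Definition _ :=
  isIdealr.Build {poly F} zero_ideal zero_ideal_closed.
Lemma zero_ideal_prime : prime_idealr_closed zero_ideal.
Proof. by move=> x y; rewrite !inE mulf_eq0. Qed.
HB.instance Definition _ :=
  isPrimeIdealrClosed.Build {poly F} zero_ideal zero_ideal_prime.

Lemma P1_generic : P1 setT.
Proof.
left; exists (zero_ideal : prime_idealr _); apply/seteqP; split=> // z _.
have [a [b [b0 ->]]] := fracP z; exists a, b; split; first by rewrite inE.
by rewrite !ev1E.
Qed.

Lemma opens_generic (U : opens) : opset U setT.
Proof.
case: U => U [sU oU] [P UP] /=; have [s [_ sPU]] := oU P UP.
by apply: sPU => //; apply: P1_generic.
Qed.

Lemma opensI_open (U V : opens) : zariski_open P1 (opset U `&` opset V).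
Proof.
case: U V => U [sU oU] neU [V [sV oV] neV] /=.
split=> [P [/sU]//|P [/oU nU /oV nV]]; exact: zariski_nbhdI.
Qed.
Definition opensI (U V : opens) : opens := Opens (opensI_open U V)
  (ex_intro _ setT (conj (opens_generic U) (opens_generic V))).
Lemma opensIl (U V : opens) : opensI U V `<=` U. Proof. by move=> P []. Qed.
Lemma opensIr (U V : opens) : opensI U V `<=` V. Proof. by move=> P []. Qed.

(** The sheaf O(m), as a subsheaf of the constant sheaf K1 x_0^m: a section
    z x_0^m is represented by its coefficient z.  The stalk is generated by
    x_0^m at the points of U_0 and by x_1^m = t^m x_0^m at those of U_1. *)
Definition twist_stalk (m : nat) (P : set K1) : set K1 :=
  mspan P [set z | (P t1 /\ z = 1) \/ (P t1^-1 /\ z = t1 ^+ m)].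

Definition twist_pred (m : nat) (U : opens) : {pred K1} :=
  fun z => `[< forall P, opset U P -> twist_stalk m P z >].

Lemma twist_pred_closed m U : zmod_closed (twist_pred m U).
Proof.
split=> [|x y].
  by apply/asboolP => P UP; apply: span0.
move=> /asboolP Ux /asboolP Uy; apply/asboolP => P UP.
by apply: spanB (opens_subring UP) _ _ _ _; [apply: Ux | apply: Uy].
Qed.
HB.instance Definition _ m U :=
  GRing.isZmodClosed.Build K1 (twist_pred m U) (twist_pred_closed m U).

Record twist_sec (m : nat) (U : opens) :=
  MkTwist { twist_val : K1; _ : twist_val \in twist_pred m U }.
HB.instance Definition _ m U := [isSub for @twist_val m U].
HB.instance Definition _ m U := [Choice of twist_sec m U by <:].
HB.instance Definition _ m U := [SubChoice_isSubZmodule of twist_sec m U by <:].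

Lemma twist_stalkP m (U : opens) (s : twist_sec m U) P :
  opset U P -> twist_stalk m P (val s).
Proof. by case: s => s /= /asboolP; apply. Qed.

Lemma twist_scale_subproof m U (a : OX U) (s : twist_sec m U) :
  val a * val s \in twist_pred m U.
Proof.
apply/asboolP => P UP; apply: spanM; first exact: opens_subring UP.
  exact: OX_stalk.
exact: twist_stalkP.
Qed.
Definition twist_scale m U (a : OX U) (s : twist_sec m U) : twist_sec m U :=
  MkTwist (twist_scale_subproof a s).

Lemma twist_scaleA m U a b (s : twist_sec m U) :
  twist_scale a (twist_scale b s) = twist_scale (a * b) s.
Proof. by apply: val_inj; rewrite /= mulrA. Qed.
Lemma twist_scale1 m U : left_id 1 (@twist_scale m U).
Proof. by move=> s; apply: val_inj; rewrite /= mul1r. Qed.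
Lemma twist_scaleDr m U : right_distributive (@twist_scale m U) +%R.
Proof. by move=> a s s'; apply: val_inj; rewrite /= mulrDr. Qed.
Lemma twist_scaleDl m U (s : twist_sec m U) :
  {morph (@twist_scale m U)^~ s : a b / a + b}.
Proof. by move=> a b; apply: val_inj; rewrite /= mulrDl. Qed.
HB.instance Definition _ m U := GRing.Zmodule_isLmodule.Build (OX U)
  (twist_sec m U) (@twist_scaleA m U) (@twist_scale1 m U) (@twist_scaleDr m U)
  (@twist_scaleDl m U).

Lemma twist_res_subproof m (U V : opens) (sVU : V `<=` U) (s : twist_sec m U) :
  val s \in twist_pred m V.
Proof. by apply/asboolP => P /sVU; apply: twist_stalkP. Qed.
Definition twist_res m (U V : opens) (sVU : V `<=` U) (s : twist_sec m U) :
  twist_sec m V := MkTwist (twist_res_subproof sVU s).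

Lemma twist_glue m (U : opens) (I : Type) (V : I -> opens)
    (sVU : forall i, V i `<=` U) (s : forall i, twist_sec m (V i)) :
    opset U `<=` \bigcup_i opset (V i) ->
    (forall i j (W : opens) (sWi : W `<=` V i) (sWj : W `<=` V j),
      twist_res sWi (s i) = twist_res sWj (s j)) ->
    exists! s0, forall i, twist_res (sVU i) s0 = s i.
Proof.
move=> cov compat.
have [i0 _ _] := cov _ (opens_generic U).
have valE i j : val (s i) = val (s j).
  by have [] := compat i j (opensI (V i) (V j)) (@opensIl _ _) (@opensIr _ _).
have sP : val (s i0) \in twist_pred m U.
  apply/asboolP => P /cov[i _ ViP]; rewrite (valE _ i); exact: twist_stalkP.
exists (MkTwist sP); split=> [i|s0 s0E]; apply: val_inj => //=.
  exact: valE.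
by rewrite -(s0E i0).
Qed.

Definition twist (m : nat) : OXmod.
Proof.
refine (@MkOXmod (fun U => twist_sec m U) (@twist_res m) _ _ _ _
  (@twist_glue m)).
- by move=> U V sVU s s'; apply: val_inj.
- by move=> U V sVU a s; apply: val_inj.
- by move=> U sUU s; apply: val_inj.
- by move=> U V W sVU sWV sWU s; apply: val_inj.
Defined.


(** The sheaf of principal parts P^k(O(n)) = p_*(O/I^(k+1) (x) q^*O(n)), with
    the left O-module structure.

    At a point Q of P^1 x P^1, the ideal of the diagonal is generated by the
    g(t) - g(u) for g regular at both p(Q) and q(Q).  Sections of q^*O(n) are
    represented by their coefficient with respect to x_0^n, as above. *)
Definition setM (G H : set K2) : set K2 := [set x * y | x in G & y in H].

Definition diag_ideal (Q : set K2) : set K2 :=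
  mspan Q [set pullp g - pullq g | g in projp Q `&` projq Q].

Fixpoint ideal_pow (Q I : set K2) (j : nat) : set K2 :=
  if j is j'.+1 then mspan Q (setM I (ideal_pow Q I j')) else Q.

Definition pullq_twist (n : nat) (Q : set K2) : set K2 :=
  mspan Q [set pullq z | z in twist_stalk n (projq Q)].

(* I^(k+1) q^*O(n), so that the stalk at Q of O/I^(k+1) (x) q^*O(n) is the
   quotient of pullq_twist n Q by it. *)
Definition pp_null (k n : nat) (Q : set K2) : set K2 :=
  mspan Q (setM (ideal_pow Q (diag_ideal Q) k.+1) (pullq_twist n Q)).

(* Lifts of the sections over p^-1(U): a section of the quotient sheaf is given
   by its germs, and around each point it is the class of a section of
   q^*O(n).  The values outside of p^-1(U) are irrelevant. *)
Definition pp_lift_pred (k n : nat) (U : opens) : {pred set K2 -> K2} :=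
  fun s => `[< forall Q, P1xP1 Q -> opset U (projp Q) ->
    exists z, zariski_nbhd P1xP1 Q [set Q' | opset U (projp Q') ->
      pullq_twist n Q' z /\ pp_null k n Q' (s Q' - z)] >].

Lemma pp_lift_pred_closed k n U : zmod_closed (pp_lift_pred k n U).
Proof.
split=> [|x y].
  apply/asboolP => Q _ _; exists 0, [::]; split=> // Q' PQ' _ _.
  by rewrite subrr; split; apply: span0.
move=> /asboolP Ux /asboolP Uy; apply/asboolP => Q PQ UQ.
have [z nz] := Ux Q PQ UQ; have [z' nz'] := Uy Q PQ UQ.
exists (z - z'); apply: zariski_nbhdS (zariski_nbhdI nz nz').
move=> Q' PQ' [hz hz'] UQ'; have [Mz Nz] := hz UQ'; have [Mz' Nz'] := hz' UQ'.
have sQ' := P1xP1_subring PQ'.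
split; first exact: spanB.
rewrite [X in pp_null _ _ _ X](_ : _ = (x Q' - z) - (y Q' - z')); last first.
  rewrite [LHS](_ : _ = x Q' - y Q' - (z - z')) // !opprB addrACA [RHS]addrACA.
  by rewrite [- z + _]addrC.
exact: spanB.
Qed.
HB.instance Definition _ k n U := GRing.isZmodClosed.Build (set K2 -> K2)
  (pp_lift_pred k n U) (pp_lift_pred_closed k n U).

Record pp_lift (k n : nat) (U : opens) :=
  MkLift { lift_val :> set K2 -> K2; _ : lift_val \in pp_lift_pred k n U }.
HB.instance Definition _ k n U := [isSub for @lift_val k n U].
HB.instance Definition _ k n U := [Choice of pp_lift k n U by <:].
HB.instance Definition _ k n U :=
  [SubChoice_isSubZmodule of pp_lift k n U by <:].

Lemma pp_liftP k n (U : opens) (s : pp_lift k n U) Q :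
  P1xP1 Q -> opset U (projp Q) ->
  exists z, zariski_nbhd P1xP1 Q [set Q' | opset U (projp Q') ->
    pullq_twist n Q' z /\ pp_null k n Q' (s Q' - z)].
Proof. by case: s => s /= /asboolP; apply. Qed.

Lemma pp_lift_scale_subproof k n U (a : OX U) (s : pp_lift k n U) :
  (fun Q => pullp (val a) * s Q) \in pp_lift_pred k n U.
Proof.
apply/asboolP => Q PQ UQ; have [z nz] := pp_liftP s PQ UQ.
exists (pullp (val a) * z); apply: zariski_nbhdS nz => Q' PQ' hz UQ'.
have [Mz Nz] := hz UQ'; have sQ' := P1xP1_subring PQ'.
have aQ' : Q' (pullp (val a)) := OX_stalk a UQ'.
by rewrite -mulrBr; split; apply: spanM.
Qed.
Definition pp_lift_scale k n U (a : OX U) (s : pp_lift k n U) : pp_lift k n U :=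
  MkLift (pp_lift_scale_subproof a s).

Lemma pp_lift_scaleA k n U a b (s : pp_lift k n U) :
  pp_lift_scale a (pp_lift_scale b s) = pp_lift_scale (a * b) s.
Proof. by apply/val_inj/funext => Q; rewrite /= pullpM mulrA. Qed.
Lemma pp_lift_scale1 k n U : left_id 1 (@pp_lift_scale k n U).
Proof. by move=> s; apply/val_inj/funext => Q; rewrite /= pullp1 mul1r. Qed.
Lemma pp_lift_scaleDr k n U : right_distributive (@pp_lift_scale k n U) +%R.
Proof. by move=> a s s'; apply/val_inj/funext => Q; rewrite /= mulrDr. Qed.
Lemma pp_lift_scaleDl k n U (s : pp_lift k n U) :
  {morph (@pp_lift_scale k n U)^~ s : a b / a + b}.
Proof.
by move=> a b; apply/val_inj/funext => Q; rewrite /= pullpD mulrDl.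
Qed.
HB.instance Definition _ k n U := GRing.Zmodule_isLmodule.Build (OX U)
  (pp_lift k n U) (@pp_lift_scaleA k n U) (@pp_lift_scale1 k n U)
  (@pp_lift_scaleDr k n U) (@pp_lift_scaleDl k n U).

Definition pp_null_pred (k n : nat) (U : opens) : {pred pp_lift k n U} :=
  fun s => `[< forall Q, P1xP1 Q -> opset U (projp Q) -> pp_null k n Q (s Q) >].

Lemma pp_null_pred_closed k n U : zmod_closed (@pp_null_pred k n U).
Proof.
split=> [|x y].
  by apply/asboolP => Q PQ UQ; apply: span0.
move=> /asboolP Ux /asboolP Uy; apply/asboolP => Q PQ UQ.
exact: (spanB (P1xP1_subring PQ) (Ux Q PQ UQ) (Uy Q PQ UQ)).
Qed.
HB.instance Definition _ k n U := GRing.isZmodClosed.Build (pp_lift k n U)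
  (@pp_null_pred k n U) (@pp_null_pred_closed k n U).

Definition pp_sec (k n : nat) (U : opens) :=
  Quotient.quot (@pp_null_pred k n U).
HB.instance Definition _ k n U := GRing.Zmodule.on (pp_sec k n U).

Lemma pp_secP k n U (s s' : pp_lift k n U) :
  \pi_(pp_sec k n U) s = \pi_(pp_sec k n U) s' <->
  forall Q, P1xP1 Q -> opset U (projp Q) -> pp_null k n Q (s Q - s' Q).
Proof.
have eqv : (s - s' \in @pp_null_pred k n U) = (s == s' %[mod pp_sec k n U]).
  exact: Quotient.idealrBE.
split=> [/eqP|H]; first by rewrite -eqv => /asboolP.
by apply/eqP; rewrite -eqv; apply/asboolP.
Qed.

Lemma pp_secW k n U (T : pp_sec k n U -> Prop) :
  (forall s, T (\pi_(pp_sec k n U) s)) -> forall s, T s.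
Proof. by move=> H s; rewrite -[s]reprK; apply: H. Qed.

Lemma repr_pi k n U (s : pp_lift k n U) Q :
  P1xP1 Q -> opset U (projp Q) ->
  pp_null k n Q (repr (\pi_(pp_sec k n U) s) Q - s Q).
Proof. by move: Q; apply/pp_secP; rewrite reprK. Qed.

Lemma pp_nullM k n Q a z : P1xP1 Q -> Q a -> pp_null k n Q z ->
  pp_null k n Q (a * z).
Proof. by move=> PQ; apply: spanM; apply: P1xP1_subring. Qed.

Lemma pp_nullD k n Q y z : P1xP1 Q -> pp_null k n Q y -> pp_null k n Q z ->
  pp_null k n Q (y + z).
Proof.
move=> PQ Ny Nz; have sQ := P1xP1_subring PQ.
rewrite -[z]opprK -[- z]sub0r; apply: spanB => //; apply: spanB => //.
exact: span0.
Qed.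

Definition pp_scale k n U (a : OX U) (s : pp_sec k n U) : pp_sec k n U :=
  \pi_(pp_sec k n U) (a *: repr s).

Lemma pi_scale k n U (a : OX U) (s : pp_lift k n U) :
  pp_scale a (\pi_(pp_sec k n U) s) = \pi_(pp_sec k n U) (a *: s).
Proof.
apply/pp_secP => Q PQ UQ; rewrite -mulrBr.
exact: pp_nullM (OX_stalk a UQ) (repr_pi s PQ UQ).
Qed.

Lemma pp_scaleA k n U a b (s : pp_sec k n U) :
  pp_scale a (pp_scale b s) = pp_scale (a * b) s.
Proof. by elim/pp_secW: s => s; rewrite !pi_scale scalerA. Qed.
Lemma pp_scale1 k n U : left_id 1 (@pp_scale k n U).
Proof. by elim/pp_secW=> s; rewrite pi_scale scale1r. Qed.
Lemma pi_ppD k n U (s s' : pp_lift k n U) :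
  \pi_(pp_sec k n U) (s + s') = \pi_(pp_sec k n U) s + \pi_(pp_sec k n U) s'.
Proof. exact: Quotient.pi_add. Qed.
Lemma pi_ppB k n U (s s' : pp_lift k n U) :
  \pi_(pp_sec k n U) (s - s') = \pi_(pp_sec k n U) s - \pi_(pp_sec k n U) s'.
Proof. by rewrite pi_ppD; congr (_ + _); apply: Quotient.pi_opp. Qed.
Lemma pp_scaleDr k n U : right_distributive (@pp_scale k n U) +%R.
Proof.
move=> a; elim/pp_secW=> s; elim/pp_secW=> s'.
rewrite -pi_ppD !pi_scale scalerDr.
exact: pi_ppD.
Qed.
Lemma pp_scaleDl k n U (s : pp_sec k n U) :
  {morph (@pp_scale k n U)^~ s : a b / a + b}.
Proof.
by move=> a b; elim/pp_secW: s => s; rewrite !pi_scale scalerDl; apply: pi_ppD.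
Qed.
HB.instance Definition _ k n U := GRing.Zmodule_isLmodule.Build (OX U)
  (pp_sec k n U) (@pp_scaleA k n U) (@pp_scale1 k n U)
  (@pp_scaleDr k n U) (@pp_scaleDl k n U).

Lemma pp_lift_res_subproof k n (U V : opens) (sVU : V `<=` U)
  (s : pp_lift k n U) : lift_val s \in pp_lift_pred k n V.
Proof.
apply/asboolP => Q PQ VQ; have [z nz] := pp_liftP s PQ (sVU _ VQ).
by exists z; apply: zariski_nbhdS nz => Q' PQ' hz VQ'; apply/hz/sVU.
Qed.
Definition pp_lift_res k n (U V : opens) (sVU : V `<=` U) (s : pp_lift k n U) :
  pp_lift k n V := MkLift (pp_lift_res_subproof sVU s).
Definition pp_res k n (U V : opens) (sVU : V `<=` U) (s : pp_sec k n U) :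
  pp_sec k n V := \pi_(pp_sec k n V) (pp_lift_res sVU (repr s)).

Lemma pi_res k n (U V : opens) (sVU : V `<=` U) (s : pp_lift k n U) :
  pp_res sVU (\pi_(pp_sec k n U) s) = \pi_(pp_sec k n V) (pp_lift_res sVU s).
Proof. by apply/pp_secP => Q PQ VQ; apply: repr_pi => //; apply: sVU. Qed.

Lemma projp_nbhd (U : opens) Q : P1xP1 Q -> opset U (projp Q) ->
  zariski_nbhd P1xP1 Q [set Q' | P1 (projp Q') -> opset U (projp Q')].
Proof.
case: U => U [sU oU] neU /= PQ UQ; have [s [sQ sU']] := oU _ UQ.
exists [seq pullp f | f <- s]; split=> [_ /mapP[f /sQ ? ->]//|Q' PQ' H PQ1].
by apply: sU' => // f fs; apply: H; apply: map_f.
Qed.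

Lemma pp_glue k n (U : opens) (I : Type) (V : I -> opens)
    (sVU : forall i, V i `<=` U) (s : forall i, pp_sec k n (V i)) :
    opset U `<=` \bigcup_i opset (V i) ->
    (forall i j (W : opens) (sWi : W `<=` V i) (sWj : W `<=` V j),
      pp_res sWi (s i) = pp_res sWj (s j)) ->
    exists! s0, forall i, pp_res (sVU i) s0 = s i.
Proof.
move=> cov compat.
have compatE i j Q : P1xP1 Q -> opset (V i) (projp Q) ->
    opset (V j) (projp Q) -> pp_null k n Q (repr (s i) Q - repr (s j) Q).
  move=> PQ iQ jQ.
  have := compat i j (opensI (V i) (V j)) (@opensIl _ _) (@opensIr _ _).
  by move=> /pp_secP; apply.
pose val0 Q := if pselect (exists i, opset (V i) (projp Q)) is left e
  then repr (s (projT1 (cid e))) Q else 0.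
have val0E i Q : P1xP1 Q -> opset (V i) (projp Q) ->
    pp_null k n Q (val0 Q - repr (s i) Q).
  move=> PQ iQ; rewrite /val0; case: pselect => [e|[]]; last by exists i.
  by apply: compatE => //; apply: projT2 (cid e).
have P0 : val0 \in pp_lift_pred k n U.
  apply/asboolP => Q PQ /cov[i _ iQ];
  have [z nz] := pp_liftP (repr (s i)) PQ iQ.
  exists z; apply: zariski_nbhdS (zariski_nbhdI nz (projp_nbhd PQ iQ)).
  move=> Q' PQ' [hz hi] UQ'.
  have iQ' : opset (V i) (projp Q') by apply: hi; apply: (opens_open U).1.
  have [Mz Nz] := hz iQ'; split=> //.
  rewrite -[val0 Q'](subrK (repr (s i) Q')) -addrA.
  by apply: pp_nullD (val0E _ _ _ _) _.
exists (\pi_(pp_sec k n U) (MkLift P0)); split.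
  by move=> i; rewrite pi_res -[s i]reprK; apply/pp_secP => Q PQ; apply: val0E.
move=> s1 s1E; rewrite -[s1]reprK; apply/pp_secP => Q PQ /cov[i _ iQ] /=.
rewrite -[val0 Q](subrK (repr (s i) Q)) -addrA.
apply: pp_nullD => //; first exact: val0E.
move: (s1E i); rewrite -{1}[s i]reprK => /esym /pp_secP; exact.
Qed.

Definition principal_parts (k n : nat) : OXmod.
Proof.
refine (@MkOXmod (fun U => pp_sec k n U) (@pp_res k n) _ _ _ _
  (@pp_glue k n)).
- move=> U V sVU; elim/pp_secW=> s; elim/pp_secW=> s'.
  by rewrite -pi_ppB !pi_res -pi_ppB; congr (\pi_(_) _); apply/val_inj.
- move=> U V sVU a; elim/pp_secW=> s.
  rewrite [_ *: _]pi_scale !pi_res [RHS]pi_scale; congr (\pi_(_) _).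
  exact/val_inj.
- move=> U sUU; elim/pp_secW=> s; rewrite pi_res; congr (\pi_(_) _).
  exact/val_inj.
- move=> U V W sVU sWV sWU; elim/pp_secW=> s; rewrite !pi_res.
  by congr (\pi_(_) _); apply/val_inj.
Defined.

Section DirectSum.
Variables (m : nat) (M : OXmod).

Definition dsum_sec (U : opens) : lmodType (OX U) := {ffun 'I_m -> M U}.

Definition dsum_res (U V : opens) (sVU : V `<=` U) (f : dsum_sec U) :
  dsum_sec V := [ffun i => res sVU (f i)].

Lemma dsum_glue (U : opens) (I : Type) (V : I -> opens)
    (sVU : forall i, V i `<=` U) (s : forall i, dsum_sec (V i)) :
    opset U `<=` \bigcup_i opset (V i) ->
    (forall i j (W : opens) (sWi : W `<=` V i) (sWj : W `<=` V j),
      dsum_res sWi (s i) = dsum_res sWj (s j)) ->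
    exists! s0, forall i, dsum_res (sVU i) s0 = s i.
Proof.
move=> cov compat.
have glue a : exists! s0, forall i, res (sVU i) s0 = s i a.
  apply: sheaf_glue => // i j W sWi sWj.
  by move: (compat i j W sWi sWj) => /ffunP/(_ a); rewrite !ffunE.
have [f fP] := choice glue; exists [ffun a => f a]; split=> [i|g gE].
  by apply/ffunP => a; rewrite !ffunE; apply: (fP a).1.
apply/ffunP => a; rewrite ffunE; apply: (fP a).2 => i.
by rewrite -(gE i) ffunE.
Qed.

Definition dsum : OXmod.
Proof.
refine (@MkOXmod dsum_sec dsum_res _ _ _ _ dsum_glue).
- move=> U V sVU f g; apply/ffunP => a; rewrite !ffunE.
  exact: res_is_zmod_morphism.
- by move=> U V sVU b f; apply/ffunP => a; rewrite !ffunE; apply: resZ.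
- by move=> U sUU f; apply/ffunP => a; rewrite !ffunE; apply: res_id.
- move=> U V W sVU sWV sWU f; apply/ffunP => a; rewrite !ffunE.
  exact: res_comp.
Defined.

Variables (N : OXmod) (f : 'I_m -> OXhom M N).

Definition hom_sum_fun (U : opens) (s : dsum U) : N U :=
  \sum_(i < m) f i U (s i).

Lemma hom_sum_linear (U : opens) : linear (@hom_sum_fun U).
Proof.
move=> a s s'; rewrite /hom_sum_fun scaler_sumr -big_split /=.
by apply: eq_bigr => i _; rewrite !ffunE linearP.
Qed.
HB.instance Definition _ (U : opens) := GRing.isLinear.Build (OX U) (dsum U)
  (N U) _ (@hom_sum_fun U) (@hom_sum_linear U).

Lemma res0 (U V : opens) (sVU : V `<=` U) : res sVU (0 : N U) = 0.
Proof. by rewrite -{1}(subrr 0) res_is_zmod_morphism subrr. Qed.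

Lemma resD (U V : opens) (sVU : V `<=` U) (s s' : N U) :
  res sVU (s + s') = res sVU s + res sVU s'.
Proof.
by rewrite -{1}[s']opprK -[- s']sub0r !res_is_zmod_morphism res0 sub0r opprK.
Qed.

Lemma hom_sum_res (U V : opens) (sVU : V `<=` U) (s : dsum U) :
  hom_sum_fun (res sVU s) = res sVU (hom_sum_fun s).
Proof.
rewrite /hom_sum_fun (big_morph (res sVU) (resD sVU) (res0 sVU)).
by apply: eq_bigr => i _; rewrite ffunE hom_res.
Qed.

Definition hom_sum : OXhom dsum N := @Hom dsum N _ hom_sum_res.

End DirectSum.

Lemma chart_open (g : K1) : zariski_open P1 (P1 `&` [set P | P g]).
Proof.
split=> [P []//|P [PX Pg]]; exists [:: g]; split=> [f|P' P'X H].
  by rewrite inE => /eqP ->.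
by split=> //; apply: H; rewrite inE.
Qed.
Definition chart (g : K1) : opens := Opens (chart_open g)
  (ex_intro _ setT (conj P1_generic I)).
Definition U0 : opens := chart t1.
Definition U1 : opens := chart t1^-1.

Lemma x0pow_subproof m : 1 \in twist_pred m U0.
Proof.
apply/asboolP => P [PX Pt]; apply: span_gen; first exact: P1_subring.
by left.
Qed.
Lemma x1pow_subproof m : t1 ^+ m \in twist_pred m U1.
Proof.
apply/asboolP => P [PX Pt]; apply: span_gen; first exact: P1_subring.
by right.
Qed.
Definition x0pow (m : nat) : twist m U0 := MkTwist (x0pow_subproof m).
Definition x1pow (m : nat) : twist m U1 := MkTwist (x1pow_subproof m).

(* s, a section over p^-1(U), is given on U x U by the section w x_0^n of
   q^*O(n).  As O/I^(k+1) is supported on the diagonal, this determines s. *)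
Definition pp_given (k n : nat) (U : opens) (s : principal_parts k n U)
    (w : K2) : Prop :=
  forall Q, P1xP1 Q -> opset U (projp Q) -> opset U (projq Q) ->
    pp_null k n Q (repr s Q - w).

(* C(n-j, l-j); the guard is needed because l - j is truncated. *)
Definition bin_sub (n l j : nat) : nat :=
  if (j <= l)%N then 'C(n - j, l - j) else 0%N.

Definition phi_coef (n r : nat) (x : 'I_r.+1 -> F) (l : nat) : F :=
  \sum_(j < r.+1) (-1) ^+ j * (bin_sub n l j)%:R * x j.

Definition is_solution (k n r : nat) (x : 'I_r.+1 -> F) : Prop :=
  (forall l : nat, (k - r + 1 <= l <= k)%N -> phi_coef n x l = 0) /\
  phi_coef n x (k - r) = 1.

Definition is_phi (k n r : nat) (x : 'I_r.+1 -> F)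
    (phi : OXhom (twist (n - k)) (principal_parts k n)) : Prop :=
  pp_given (phi U0 (x0pow (n - k)))
    (\sum_(l < (k - r).+1)
      c2 (phi_coef n x l) * t2 ^+ (k - r - l) * (u2 - t2) ^+ l) /\
  (* t^(j-r) is written t^-(r-j), and x_1^n = u^n x_0^n *)
  pp_given (phi U1 (x1pow (n - k)))
    (\sum_(j < r.+1)
      c2 (x j) * t2 ^- (r - j) * (u2^-1 - t2^-1) ^+ j * u2 ^+ n).

Definition is_phi0 (k n : nat)
    (phi : OXhom (twist (n - k)) (principal_parts k n)) : Prop :=
  pp_given (phi U0 (x0pow (n - k)))
    (\sum_(l < k.+1) 'C(n, l)%:R * t2 ^+ (k - l) * (u2 - t2) ^+ l) /\
  pp_given (phi U1 (x1pow (n - k))) (u2 ^+ n).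

End ProjectiveLine.

(* Main.v *)
From HB Require Import structures.
Require Import Defs.
From mathcomp Require Import all_boot all_algebra.
From mathcomp Require Import perm boolp classical_sets functions.
From mathcomp Require Import ring zify.

Set Implicit Arguments.
Unset Strict Implicit.
Unset Printing Implicit Defensive.

Import GRing.Theory.
Local Open Scope classical_set_scope.
Local Open Scope ring_scope.
Local Open Scope quotient_scope.

(** Why the sum of the phi_r is an isomorphism.  Over each chart of P^1 the
    sheaf of principal parts is free on the powers of the equation of the
    diagonal, dt^l (x) x_0^n or ds^l (x) x_1^n, so the k+1 maps have a matrix
    with entries in F[t], resp. F[1/t].  Over U_0, the equations of the linear
    system say that phi_r has no term in dt^l for k-r < l <= k and the
    coefficient 1 at dt^(k-r), if r >= 1; hence the matrix is triangular up to a
    permutation of its rows, with the constants C(n, k), 1, ..., 1 on the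
    diagonal.  Over U_1 it is triangular with 1, x_(1,1), ..., x_(k,k) on the
    diagonal.  Both matrices are therefore invertible over the coordinate
    rings ([phi_row_unit]).

    The linear systems.  With d = n-k and i = k-l, the product formula
    C(n-j, d+i) C(d+i, d) = C(n-j, d) C(k-j, i) rescales the matrix of the
    system to C(k-j, i), 0 <= i, j <= r ([phi_coefE]).  The alternating sum of
    the polynomials C(X, i), i <= r, with weights C(r, j), is their r-th
    difference: it kills all of them but the last one, which solves the system
    ([sum_alt_bin]).  Conversely the combination of the rows that equals
    C(j, r), and so vanishes for j < r, computes x_(r,r) and shows that it is
    not zero ([sum_alt_bin_vanish], [is_solution_top]).

    The phi_r exist.  Expanded in powers of u - t, the formula on U_1 is
    t^(n-k) times the formula on U_0, plus terms of order l > k-r; those with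
    l <= k vanish because of the system, and the others are in I^(k+1)
    ([phi_vec_compat]).

    From matrices to sheaves.  A section of O/I^(k+1) is determined by its
    germs at the points Q of the diagonal ([pp_eq_ondiag]).  At such a point,
    lying over P, the restriction to u = t makes the quotient of Q by the
    equation of the diagonal equal to P; hence a Taylor expansion
    ([diag_taylor]) with coefficients in P, and every germ is a combination of
    the phi_r with coefficients in P ([frame_span]).  At the generic point of
    the diagonal these coefficients are unique ([generic_indep],
    [frame_indep]).  All the local rings of points of the diagonal are
    contained in the one of its generic point ([ondiag_generic]), so the
    coefficients computed at the generic point belong to P for all P in the
    given open set: they are sections of O(n-k) ([frame_surj]).  The sum of
    the phi_r is thus bijective on the sections over every open set. *)

(** * Subrings of a field, their units and principal ideals *)

(** The condition [x != 0] is needed since [0^-1 = 0]. *)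
Definition inv_in (E : fieldType) (S : set E) (x : E) : Prop :=
  x != 0 /\ S x^-1.

(** The ideal c S, as a subset of the field. *)
Definition princ (E : fieldType) (c : E) (S : set E) : set E :=
  [set c * q | q in S].

Definition local_set (E : fieldType) (S : set E) : Prop :=
  forall x y, S x -> S y -> x + y = 1 -> inv_in S x \/ inv_in S y.

Section SubringSet.
Variables (E : fieldType) (S : set E).
Hypothesis sS : subring_set S.

Lemma subring1 : S 1. Proof. by case: sS. Qed.
Lemma subringB x y : S x -> S y -> S (x - y).
Proof. by case: sS => _ + _; apply. Qed.
Lemma subringM x y : S x -> S y -> S (x * y).
Proof. by case: sS => _ _; apply. Qed.
Lemma subring0 : S 0.
Proof. by rewrite -(subrr 1); apply: subringB; apply: subring1. Qed.
Lemma subringN x : S x -> S (- x).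
Proof. by rewrite -sub0r; apply/subringB/subring0. Qed.
Lemma subringD x y : S x -> S y -> S (x + y).
Proof. by move=> Sx Sy; rewrite -[y]opprK; apply/subringB/subringN. Qed.
Lemma subringX x m : S x -> S (x ^+ m).
Proof.
move=> Sx; elim: m => [|m IH]; first by rewrite expr0; apply: subring1.
by rewrite exprS; apply: subringM.
Qed.
Lemma subring_sum (I : Type) (r : seq I) (p : pred I) (f : I -> E) :
  (forall i, p i -> S (f i)) -> S (\sum_(i <- r | p i) f i).
Proof.
by move=> H; apply: (big_ind S) => //; [exact: subring0|exact: subringD].
Qed.

Lemma inv_inM x y : inv_in S x -> inv_in S y -> inv_in S (x * y).
Proof.
move=> [x0 Sx] [y0 Sy]; split; first by rewrite mulf_neq0.
by rewrite invfM; apply: subringM.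
Qed.

Lemma inv_in_factor x y : S x -> S y -> inv_in S (x * y) -> inv_in S x.
Proof.
move=> Sx Sy [xy0 Sxy]; have := xy0; rewrite mulf_eq0 negb_or => /andP[x0 y0].
split=> //; have -> : x^-1 = y * (x * y)^-1.
  by rewrite invfM mulrCA divff ?mulr1.
exact: subringM.
Qed.

Lemma princP c z : S z -> princ c S (c * z). Proof. by exists z. Qed.

Lemma princ1 : princ 1 S = S.
Proof.
apply/seteqP; split=> [_ [q Sq <-]|z Sz]; first by rewrite mul1r.
by exists z; rewrite ?mul1r.
Qed.

Lemma princ_unit c : c != 0 -> princ c S 1 <-> inv_in S c.
Proof.
move=> c0; split=> [[q Sq cq1]|[_ Sc]]; last first.
  by exists c^-1; rewrite ?divff.
by split=> //; rewrite -[c^-1]mulr1 -cq1 mulKf.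
Qed.

Lemma princD c x y : princ c S x -> princ c S y -> princ c S (x + y).
Proof.
move=> [q Sq <-] [r Sr <-]; rewrite -mulrDr; exact/princP/subringD.
Qed.
Lemma princM c a x : S a -> princ c S x -> princ c S (a * x).
Proof. by move=> Sa [q Sq <-]; rewrite mulrCA; apply/princP/subringM. Qed.

Lemma mspan_sub (G T : set E) : T 0 ->
  (forall x y, T x -> T y -> T (x + y)) ->
  (forall a x, S a -> G x -> T (a * x)) -> mspan S G `<=` T.
Proof.
move=> T0 TD TG _ [s [sG ->]]; rewrite big_seq.
by apply: (big_ind T) => // x /sG[Sx Gx]; apply: TG.
Qed.

Lemma mspan_princ (G : set E) c : mspan S G c -> G `<=` princ c S ->
  mspan S G = princ c S.
Proof.
move=> Gc sG; apply/seteqP; split=> [|_ [q Sq <-]]; last first.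
  by rewrite mulrC; apply: spanM.
apply: mspan_sub => [|x y|a x Sa /sG]; last exact: princM.
- by rewrite -(mulr0 c); apply/princP/subring0.
- exact: princD.
Qed.

(** In a local ring the non-units form an ideal. *)
Lemma local_add x y h : local_set S -> S x -> S y -> S h ->
  inv_in S x -> ~ inv_in S y -> inv_in S (x + y * h).
Proof.
move=> lS Sx Sy Sh [x0 Sx'] ny; set w := x + y * h.
have Sw : S w by apply/subringD => //; apply: subringM.
have [] := lS (w * x^-1) (- (y * h) * x^-1).
- exact: subringM.
- by apply/subringM => //; apply/subringN/subringM.
- by rewrite -mulrDl addrK divff.
- exact: inv_in_factor.
- rewrite -mulrN -mulrA => /inv_in_factor H.
  by case: ny; apply: H => //; apply/subringM => //; apply: subringN.
Qed.

End SubringSet.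

Lemma setM_princ (F : fieldType) (Q : set (K2 F)) x y : subring_set Q ->
  mspan Q (setM (princ x Q) (princ y Q)) = princ (x * y) Q.
Proof.
move=> sQ; apply: mspan_princ => //.
  have Q1 := subring1 sQ; apply: span_gen => //.
  by exists x; [|exists y => //]; exists 1; rewrite ?mulr1.
move=> _ [_ [q Qq <-] [_ [r Qr <-] <-]]; rewrite mulrACA.
by apply: princP; apply: subringM.
Qed.

Lemma mspanD (E : fieldType) (S G : set E) x y : subring_set S ->
  mspan S G x -> mspan S G y -> mspan S G (x + y).
Proof.
move=> sS Gx Gy; rewrite -[y]opprK -[- y]sub0r; apply: spanB => //.
by apply: spanB => //; apply: span0.
Qed.

(** * Localizations at a prime *)

Section LocalRing.
Variables (R : idomainType) (E : fieldType) (h : {rmorphism R -> E}).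
Hypothesis h_inj : injective h.
Variable p : prime_idealr R.

Let h_neq0 g : g \notin p -> h g != 0.
Proof.
by move=> pg; rewrite raddf_eq0 //; apply: contraNneq pg => ->; apply: rpred0.
Qed.

Lemma local_ring_unit g : g \notin p -> inv_in (local_ring h p) (h g).
Proof.
move=> pg; split; first exact: h_neq0.
by exists 1, g; rewrite rmorph1 div1r.
Qed.

Lemma local_ring_ev f : local_ring h p (h f).
Proof. by exists f, 1; rewrite rmorph1 divr1 idealr1. Qed.

(** A unit lies outside of the prime, which is a proper ideal. *)
Lemma local_ring_inv g : inv_in (local_ring h p) (h g) -> g \notin p.
Proof.
case=> g0 [f [f' [pf' e]]]; apply: contra pf' => pg.
have -> : f' = f * g.
  apply: h_inj; rewrite rmorphM.
  have f'0 : h f' != 0.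
    by apply: contraNneq (invr_neq0 g0) => f'0; rewrite e f'0 invr0 mulr0.
  by apply: (mulIf (invr_neq0 g0)); rewrite mulfK // e mulrCA divff // mulr1.
exact: idealMr.
Qed.

Lemma local_ring_local : local_set (local_ring h p).
Proof.
move=> _ _ [f [g [pg ->]]] [f' [g' [pg' ->]]] e.
have {e}e : f * g' + f' * g = g * g'.
  apply: h_inj; rewrite rmorphD !rmorphM.
  by rewrite -(mulr1 (h g * h g')) -e; field; rewrite !h_neq0.
have inv a b : a \notin p -> b \notin p -> inv_in (local_ring h p) (h a / h b).
  move=> pa pb; split; first by rewrite mulf_neq0 ?invr_eq0 ?h_neq0.
  by exists b, a; rewrite invf_div.
have [pf|pf] := boolP (f \in p); last by left; apply: inv.
have [pf'|pf'] := boolP (f' \in p); last by right; apply: inv.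
have : g * g' \in p by rewrite -e rpredD // mulrC idealMr.
by rewrite prime_idealrM (negPf pg) (negPf pg').
Qed.

End LocalRing.

(** The point of the diagonal over p: its preimage under u := t. *)
Definition diag_pred (F : fieldType) (p : prime_idealr {poly F}) :
  {pred {poly {poly F}}} := fun f => f.['X] \in p.

Lemma diag_pred_idealr (F : fieldType) (p : prime_idealr {poly F}) :
  idealr_closed (diag_pred p).
Proof.
split; rewrite /in_mem /= /diag_pred ?horner0 ?hornerC ?idealr1 ?rpred0 //.
move=> a x y px py; rewrite hornerD hornerM rpredD //.
by rewrite idealMr.
Qed.
HB.instance Definition _ (F : fieldType) (p : prime_idealr {poly F}) :=
  isIdealr.Build {poly {poly F}} (@diag_pred F p)
  (diag_pred_idealr p).

Lemma diag_pred_prime (F : fieldType) (p : prime_idealr {poly F}) :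
  prime_idealr_closed (diag_pred p).
Proof.
by move=> f g; rewrite /in_mem /= /diag_pred hornerM prime_idealrM.
Qed.
HB.instance Definition _ (F : fieldType) (p : prime_idealr {poly F}) :=
  isPrimeIdealrClosed.Build {poly {poly F}}
  (@diag_pred F p) (@diag_pred_prime F p).

(** * Evaluation of polynomials *)

Lemma evp_polyC (R : comNzRingType) (E : fieldType) (c : {rmorphism R -> E})
    a r :
  evp c a r%:P = c r.
Proof. by rewrite /evp map_polyC hornerC. Qed.
Lemma evp_polyX (R : comNzRingType) (E : fieldType) (c : {rmorphism R -> E}) a :
  evp c a 'X = a.
Proof. by rewrite /evp map_polyX hornerX. Qed.

Lemma evp_in (R : comNzRingType) (E : fieldType) (c : {rmorphism R -> E}) a
    (S : set E) f :
  subring_set S -> (forall r, S (c r)) -> S a -> S (evp c a f).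
Proof.
move=> sS Sc Sa; elim/poly_ind: f => [|f r IH].
  by rewrite rmorph0; apply: subring0.
rewrite rmorphD rmorphM /= evp_polyX evp_polyC.
by apply: subringD => //; apply: subringM.
Qed.

(** Reversing a polynomial turns an expression in 1/a into one in a. *)
Lemma evp_inv (R : comNzRingType) (E : fieldType) (c : {rmorphism R -> E}) a f :
  a != 0 -> exists g, evp c a^-1 f * a ^+ size f = evp c a g.
Proof.
move=> a0; exists (\sum_(i < size f) (f`_i)%:P * 'X ^+ (size f - i)).
rewrite rmorph_sum (evpE c a^-1 (leqnn _)) mulr_suml; apply: eq_bigr => i _.
rewrite rmorphM rmorphXn /= evp_polyC evp_polyX -mulrA; congr (_ * _).
by rewrite expfB_cond ?(negPf a0) ?(ltnW (ltn_ord i)) // exprVn mulrC.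
Qed.

(** * Identities between fractions *)

Lemma frac_expand (E : fieldType) (x y v w : E) : y != 0 -> v != 0 ->
  w != 0 -> x / y = (x * v * w) / (y * w * v).
Proof. by move=> y0 v0 w0; field; rewrite y0 w0 v0. Qed.

Lemma chart_change_frac (E : fieldType) (x y a b w w' : E) :
  x * w = a -> y * w' = b -> y != 0 -> w != 0 -> w' != 0 ->
  b * w != 0 /\ x / y = (a * w') / (b * w).
Proof.
move=> <- <- y0 w0 w'0; split; first by rewrite !mulf_neq0.
by field; rewrite y0 w0 w'0.
Qed.

Lemma inv_bezout (E : fieldType) (x y a b : E) : y != 0 -> a * x + b * y = 1 ->
  y^-1 = a * (x / y) + b.
Proof. by move=> y0 e; rewrite -[LHS]mul1r -e; field. Qed.

Lemma frac_sub_diag (E : fieldType) (x y y' d h h' : E) : y != 0 -> y' != 0 ->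
  y' = y + d * h' ->
  x / y - (x + d * h) / y' = d * ((x * h' - h * y) * (y^-1 * y'^-1)).
Proof.
move=> y0 y'0 e; have -> : x / y - (x + d * h) / y' =
  (x * (y' - y) - d * h * y) / (y * y') by field; rewrite y0 y'0.
by rewrite e addrAC subrr add0r; field; rewrite -e y0 y'0.
Qed.

Lemma inv1B_inv (E : fieldType) (y : E) : y != 0 ->
  (1 - y^-1)^-1 = - (y * (1 - y)^-1).
Proof.
move=> y0; have -> : 1 - y^-1 = - ((1 - y) / y) by field.
by rewrite invrN invf_div.
Qed.

Lemma frac_opposite (E : fieldType) (x y : E) :
  y != 0 -> 1 - x != 0 -> 1 - y != 0 -> 1 - x * y != 0 ->
  1 = (1 - x * y)^-1 * ((1 - x) * (1 - y)) * ((1 - x)^-1 - (1 - y^-1)^-1).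
Proof.
by move=> y0 x1 y1 xy1; rewrite inv1B_inv //; field; rewrite x1 y1 xy1.
Qed.

(** Since 1/u - 1/t = - (u - t) / (ut), the left-hand side is a multiple of
    (u - t)^j u^(n-j); then expand u = t + (u - t). *)
Lemma inv_diff_expansion (E : fieldType) (n r j : nat) (t u : E) :
  t != 0 -> u != 0 -> (j <= r <= n)%N ->
  t ^- (r - j) * (u^-1 - t^-1) ^+ j * u ^+ n =
  \sum_(l < n.+1)
    (-1) ^+ j * (Defs.bin_sub n l j)%:R *
    (t ^- r * (t ^+ (n - l) * (u - t) ^+ l)).
Proof.
move=> t0 u0 /andP[jr rn]; have jn := leq_trans jr rn.
have -> : u^-1 - t^-1 = - 1 * (u - t) * (t^-1 * u^-1) by field; rewrite t0 u0.
rewrite !exprMn !exprVn.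
have tj : t ^- (r - j) * t ^- j = t ^- r.
  by rewrite -invfM -exprD subnK.
have uj : u ^- j * u ^+ n = u ^+ (n - j).
  by rewrite -{1}(subnKC jn) exprD mulKf ?expf_neq0.
transitivity ((-1) ^+ j * t ^- r * ((u - t) ^+ j * u ^+ (n - j))).
  by rewrite -tj -uj; ring.
have -> : u ^+ (n - j) = \sum_(i < (n - j).+1)
    (t ^+ (n - j - i) * (u - t) ^+ i) *+ 'C(n - j, i).
  by rewrite -exprDn addrC subrK.
rewrite -(big_mkord xpredT (fun l => (-1) ^+ j * (Defs.bin_sub n l j)%:R *
  (t ^- r * (t ^+ (n - l) * (u - t) ^+ l)))).
rewrite (big_cat_nat (leq0n j)) /=; last by apply: leqW.
rewrite [X in _ = X + _]big_nat_cond.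
rewrite [X in _ = X + _]big1 ?add0r => [|l]; last first.
  by move=> /andP[/andP[_ lj] _]; rewrite /Defs.bin_sub leqNgt lj mulr0 mul0r.
rewrite -[X in \sum_(X <= _ < _) _]add0n big_addn subSn // big_mkord !mulr_sumr.
apply: eq_bigr => i _; rewrite /Defs.bin_sub leq_addl addnK exprD -mulr_natr.
have -> : (n - (i + j) = n - j - i)%N by lia.
by ring.
Qed.

(** * Coordinates on the two factors *)

Section Points.
Variable F : fieldType.
Local Notation K1 := (K1 F).
Local Notation K2 := (K2 F).
Local Notation t1 := (t1 F).
Local Notation t2 := (t2 F).
Local Notation u2 := (u2 F).

Let tofrac_inj (R : idomainType) : injective (@FracField.tofrac R).
Proof. by move=> x y /eqP; rewrite tofrac_eq => /eqP. Qed.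

HB.instance Definition _ (a b : K2) := GRing.RMorphism.copy (@ev2 F a b)
  (evp (evp (@c2 F) a) b).
HB.instance Definition _ (a : K1) := GRing.RMorphism.copy (@ev1 F a)
  (evp (@c1 F) a).

Lemma morphD_zmod (E E' : fieldType) (h : E -> E') :
  (forall x y, h (x + y) = h x + h y) -> zmod_morphism h.
Proof.
move=> hD x y; apply: (addIr (h y)).
by rewrite -hD !subrK.
Qed.

HB.instance Definition _ := GRing.isZmodMorphism.Build K1 K2 (@pullp F)
  (morphD_zmod (@pullpD F)).
HB.instance Definition _ := GRing.isMonoidMorphism.Build K1 K2 (@pullp F)
  (conj (pullp1 F) (@pullpM F)).
HB.instance Definition _ := GRing.isZmodMorphism.Build K1 K2 (@pullq F)
  (morphD_zmod (@pullqD F)).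
HB.instance Definition _ := GRing.isMonoidMorphism.Build K1 K2 (@pullq F)
  (conj (pullq1 F) (@pullqM F)).

Lemma evp_t2_inj : injective (evp (@c2 F) t2).
Proof. by move=> f g; rewrite !evp_t2 => /tofrac_inj/polyC_inj. Qed.

Lemma ev2_map a b f : ev2 a b (map_poly polyC f) = evp (@c2 F) b f.
Proof.
rewrite /ev2 {1}/evp -map_poly_comp_id0 ?rmorph0 // [RHS]/evp.
congr (_.[_]); apply: eq_map_poly => r /=.
by rewrite /= evp_polyC.
Qed.

Lemma evp_u2_inj : injective (evp (@c2 F) u2).
Proof.
move=> f g; rewrite -!(ev2_map t2) => /ev2_inj h.
by apply: (map_inj_poly (@polyC_inj F) (polyC0 F)); apply: h;
  rewrite !inE eqxx.
Qed.

Lemma pullp_tofrac f : pullp (FracField.tofrac f) = evp (@c2 F) t2 f.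
Proof.
have := frac_lift_frac evp_t2_inj f (oner_neq0 _).
by rewrite !rmorph1 !divr1.
Qed.
Lemma pullq_tofrac f : pullq (FracField.tofrac f) = evp (@c2 F) u2 f.
Proof.
have := frac_lift_frac evp_u2_inj f (oner_neq0 _).
by rewrite !rmorph1 !divr1.
Qed.

Lemma pullp_t1 : pullp t1 = t2. Proof. by rewrite pullp_tofrac evp_polyX. Qed.
Lemma pullq_t1 : pullq t1 = u2. Proof. by rewrite pullq_tofrac evp_polyX. Qed.
Lemma pullp_c1 c : pullp (c1 c) = c2 c :> K2.
Proof. by rewrite /c1 pullp_tofrac evp_polyC. Qed.
Lemma pullq_c1 c : pullq (c1 c) = c2 c :> K2.
Proof. by rewrite /c1 pullq_tofrac evp_polyC. Qed.

(** The coordinate of P^1 centred at 0 or, for [true], at infinity. *)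
Definition tcoord (c : bool) : K1 := if c then t1^-1 else t1.

Local Notation A c := (pullp (tcoord c)).
Local Notation B c := (pullq (tcoord c)).
Local Notation ev c := (ev2 (A c) (B c)).

Lemma pullp_tcoord c : A c = if c then t2^-1 else t2.
Proof. by case: c; rewrite ?fmorphV /= pullp_t1. Qed.
Lemma pullq_tcoord c : B c = if c then u2^-1 else u2.
Proof. by case: c; rewrite ?fmorphV /= pullq_t1. Qed.

Lemma tcoord_neq0 c : tcoord c != 0.
Proof. by case: c; rewrite /= ?invr_eq0 t1_neq0. Qed.

Lemma pullp_tcoordN c : A (~~ c) = (A c)^-1.
Proof. by rewrite !pullp_tcoord; case: c; rewrite /= ?invrK. Qed.
Lemma pullq_tcoordN c : B (~~ c) = (B c)^-1.
Proof. by rewrite !pullq_tcoord; case: c; rewrite /= ?invrK. Qed.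

Lemma pullp_tcoord_neq0 c : A c != 0.
Proof. by rewrite fmorph_eq0 tcoord_neq0. Qed.
Lemma pullq_tcoord_neq0 c : B c != 0.
Proof. by rewrite fmorph_eq0 tcoord_neq0. Qed.

Lemma ev_inj c d : injective (ev2 (A c) (B d)).
Proof.
by rewrite pullp_tcoord pullq_tcoord; apply: ev2_inj; case: c d => [] [];
  rewrite !inE eqxx ?orbT.
Qed.

Lemma pullp_ev1 a f : pullp (ev1 a f) = evp (@c2 F) (pullp a) f.
Proof.
have e : map_poly (@c2 F) f = map_poly (@pullp F) (map_poly (@c1 F) f).
  rewrite -map_poly_comp_id0 ?rmorph0 //.
  by apply: eq_map_poly => r /=; rewrite pullp_c1.
by rewrite /ev1 /evp e horner_map.
Qed.
Lemma pullq_ev1 a f : pullq (ev1 a f) = evp (@c2 F) (pullq a) f.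
Proof.
have e : map_poly (@c2 F) f = map_poly (@pullq F) (map_poly (@c1 F) f).
  rewrite -map_poly_comp_id0 ?rmorph0 //.
  by apply: eq_map_poly => r /=; rewrite pullq_c1.
by rewrite /ev1 /evp e horner_map.
Qed.

Lemma ev1_polyX a : @ev1 F a 'X = a.
Proof. exact: evp_polyX. Qed.
Lemma ev2_polyC a b f : ev2 a b f%:P = evp (@c2 F) a f.
Proof. by rewrite /ev2 evp_polyC. Qed.
Lemma ev2_polyX a b : @ev2 F a b 'X = b.
Proof. by rewrite /ev2 evp_polyX. Qed.
Lemma ev2_Xp a b m : @ev2 F a b ('X ^+ m)%:P = a ^+ m.
Proof. by rewrite ev2_polyC rmorphXn /= evp_polyX. Qed.
Lemma ev2_Xq a b m : @ev2 F a b ('X ^+ m) = b ^+ m.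
Proof. by rewrite rmorphXn /= ev2_polyX. Qed.
Lemma ev2_sub a b : @ev2 F a b ('X - 'X%:P) = b - a.
Proof.
have -> : @ev2 F a b ('X - 'X%:P) = ev2 a b 'X - ev2 a b 'X%:P.
  exact: rmorphB.
by rewrite ev2_polyX ev2_polyC evp_polyX.
Qed.
(** Restriction to the diagonal is the substitution u := t; the difference is
    divisible by u - t. *)
Lemma ev_diag c f : exists h,
  ev c f = pullp (ev1 (tcoord c) f.['X]) + (B c - A c) * ev c h.
Proof.
have : root (f - (f.['X])%:P) 'X.
  by rewrite /root hornerD hornerN hornerC subrr.
move=> /factor_theorem[h /eqP]; rewrite subr_eq => /eqP {1}->; exists h.
rewrite rmorphD rmorphM rmorphB /= ev2_polyX !ev2_polyC evp_polyX pullp_ev1.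
by rewrite addrC mulrC.
Qed.

(** * Points of the line and of its square *)

Local Notation P1 := (@P1 F).
Local Notation P1xP1 := (@P1xP1 F).

Lemma P1P P : P1 P <-> exists c (p : prime_idealr {poly F}),
  P = local_ring (ev1 (tcoord c)) p.
Proof.
split=> [[] [p ->]|[[] [p ->]]]; first by exists false, p.
- by exists true, p.
- by right; exists p.
- by left; exists p.
Qed.

Lemma P1xP1P Q : P1xP1 Q <-> exists c d (p : prime_idealr {poly {poly F}}),
  Q = local_ring (ev2 (A c) (B d)) p.
Proof.
split=> [[] [] [p ->]|[c [d [p ->]]]].
- by exists false, false, p; rewrite pullp_tcoord pullq_tcoord.
- by exists false, true, p; rewrite pullp_tcoord pullq_tcoord.
- by exists true, false, p; rewrite pullp_tcoord pullq_tcoord.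
- by exists true, true, p; rewrite pullp_tcoord pullq_tcoord.
by rewrite pullp_tcoord pullq_tcoord; case: c d => [] [];
  [right; right|right; left|left; right|left; left]; exists p.
Qed.

Lemma local_ring2 c d (p : prime_idealr {poly {poly F}}) f :
  local_ring (ev2 (A c) (B d)) p (ev2 (A c) (B d) f).
Proof. exact: local_ring_ev. Qed.

Lemma local_ring2_p c d (p : prime_idealr {poly {poly F}}) :
  local_ring (ev2 (A c) (B d)) p (A c).
Proof. by have := local_ring2 c d p 'X%:P; rewrite ev2_polyC evp_polyX. Qed.

Lemma local_ring2_q c d (p : prime_idealr {poly {poly F}}) :
  local_ring (ev2 (A c) (B d)) p (B d).
Proof. by have := local_ring2 c d p 'X; rewrite ev2_polyX. Qed.

Lemma tcoord_frac c (z : K1) : exists f g,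
  ev1 (tcoord c) g != 0 /\ z = ev1 (tcoord c) f / ev1 (tcoord c) g.
Proof.
have [a [b [b0 ->]]] := fracP z; rewrite -!ev1E.
have {}b0 : ev1 t1 b != 0 by rewrite ev1E tofrac_eq0.
case: c => /=; last by exists a, b.
have t0 : t1^-1 != 0 by rewrite invr_eq0 t1_neq0.
have inv f : exists g, ev1 t1 f * t1^-1 ^+ size f = ev1 t1^-1 g.
  by have [g] := evp_inv (@c1 F) f t0; rewrite invrK => gE; exists g.
have [a' ea] := inv a; have [b' eb] := inv b.
exists (a' * 'X ^+ size b), (b' * 'X ^+ size a).
rewrite !rmorphM !rmorphXn /= ev1_polyX.
by apply: chart_change_frac ea eb _ _ _; rewrite ?expf_neq0.
Qed.

Section Point.
Variable Q : set K2.
Hypothesis PQ : P1xP1 Q.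

Let sQ : subring_set Q. Proof. exact: P1xP1_subring. Qed.

Lemma point_local : local_set Q.
Proof.
have [c [d [p ->]]] := (P1xP1P Q).1 PQ.
exact/local_ring_local/ev_inj.
Qed.

Lemma point_const r : Q (c2 r).
Proof.
have [c [d [p ->]]] := (P1xP1P Q).1 PQ.
by have := local_ring2 c d p r%:P%:P; rewrite ev2_polyC evp_polyC.
Qed.

Lemma point_coordp : exists c, Q (A c).
Proof.
have [c [d [p ->]]] := (P1xP1P Q).1 PQ; exists c.
exact: local_ring2_p.
Qed.

Lemma point_coordq : exists c, Q (B c).
Proof.
have [c [d [p ->]]] := (P1xP1P Q).1 PQ; exists d.
exact: local_ring2_q.
Qed.

Lemma point_ev c f : Q (A c) -> Q (B c) -> Q (ev c f).
Proof.
move=> QA QB; apply: evp_in => // r.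
by apply: evp_in => //; apply: point_const.
Qed.

Lemma projp_subring : subring_set (projp Q).
Proof.
split=> [|x y|x y]; rewrite /projp /=.
- by rewrite rmorph1; apply: subring1.
- by rewrite rmorphB; apply: subringB.
- by rewrite rmorphM; apply: subringM.
Qed.

Lemma projq_subring : subring_set (projq Q).
Proof.
split=> [|x y|x y]; rewrite /projq /=.
- by rewrite rmorph1; apply: subring1.
- by rewrite rmorphB; apply: subringB.
- by rewrite rmorphM; apply: subringM.
Qed.

Lemma projp_ev1 c f : Q (A c) -> projp Q (ev1 (tcoord c) f).
Proof.
move=> QA; rewrite /projp /= pullp_ev1.
by apply: evp_in => //; apply: point_const.
Qed.

Lemma projq_ev1 c f : Q (B c) -> projq Q (ev1 (tcoord c) f).
Proof.
move=> QB; rewrite /projq /= pullq_ev1.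
by apply: evp_in => //; apply: point_const.
Qed.

Let coordp_unit c : Q (A c) -> Q (A (~~ c)) -> inv_in Q (A c).
Proof.
by move=> _; rewrite pullp_tcoordN; split=> //; apply: pullp_tcoord_neq0.
Qed.
Let coordq_unit c : Q (B c) -> Q (B (~~ c)) -> inv_in Q (B c).
Proof.
by move=> _; rewrite pullq_tcoordN; split=> //; apply: pullq_tcoord_neq0.
Qed.

Let inv_inX x m : inv_in Q x -> inv_in Q (x ^+ m).
Proof.
move=> [x0 Qx]; split; first by rewrite expf_neq0.
by rewrite -exprVn; apply: subringX.
Qed.

Let change_p c c' b f : Q (A c) -> Q (A c') -> exists f' h,
  ev2 (A c') b f * ev2 (A c) b h = ev2 (A c) b f' /\ inv_in Q (ev2 (A c) b h).
Proof.
move=> QA QA'; have [->|cc'] := eqVneq c' c.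
  exists f, 1; rewrite rmorph1 mulr1; split=> //.
  by split; rewrite ?oner_neq0 // invr1; apply: subring1.
have {cc'} cE : c' = ~~ c by move: cc'; case: c c' {QA QA'} => [] [].
subst c'; have A0 := pullp_tcoord_neq0 c.
have [g gE] := evp_inv (evp (@c2 F) b) (swapXY f) A0.
exists (swapXY g), ('X ^+ size (swapXY f))%:P.
rewrite ev2_Xp pullp_tcoordN; split.
  by rewrite /ev2 [in RHS]evp_swap swapXYK -gE evp_swap.
exact/inv_inX/coordp_unit.
Qed.

Let change_q c d f : Q (A c) -> Q (B c) -> Q (B d) -> exists f' h,
  ev2 (A c) (B d) f * ev c h = ev c f' /\ inv_in Q (ev c h).
Proof.
move=> QA QB QB'; have [->|cc'] := eqVneq d c.
  exists f, 1; rewrite rmorph1 mulr1; split=> //.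
  by split; rewrite ?oner_neq0 // invr1; apply: subring1.
have {cc'} cE : d = ~~ c by move: cc'; case: c d {QA QB QB'} => [] [].
subst d; have B0 := pullq_tcoord_neq0 c.
have [g gE] := evp_inv (evp (@c2 F) (A c)) f B0.
exists g, ('X ^+ size f); rewrite ev2_Xq pullq_tcoordN.
split; first exact: gE.
exact/inv_inX/coordq_unit.
Qed.

(** The point may have been given in other charts.  Polynomials in 1/x become
    polynomials in x once multiplied by a power of x, and x is a unit at the
    points where both x and 1/x are regular. *)
Lemma chart_frac c z : Q (A c) -> Q (B c) -> Q z ->
  exists f g, inv_in Q (ev c g) /\ z = ev c f / ev c g.
Proof.
move=> QA QB; have [c' [d [p QE]]] := (P1xP1P Q).1 PQ.
have QA' : Q (A c') by rewrite QE; apply: local_ring2_p.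
have QB' : Q (B d) by rewrite QE; apply: local_ring2_q.
have change f : exists f' h,
    ev2 (A c') (B d) f * ev c h = ev c f' /\ inv_in Q (ev c h).
  have [f1 [h1 [e1 i1]]] := change_p (B d) f QA QA'.
  have [f2 [h2 [e2 i2]]] := change_q f1 QA QB QB'.
  have [h3 [h4 [e3 i3]]] := change_q h1 QA QB QB'.
  exists (f2 * h4), (h3 * h2); rewrite !rmorphM /= -e2 -e1 -e3.
  split; first by ring.
  by do 2![apply: inv_inM => //].
move=> Qz.
have [f [g [pg ->]]] : local_ring (ev2 (A c') (B d)) p z by rewrite -QE.
have [f' [hf [ef uf]]] := change f; have [g' [hg [eg ug]]] := change g.
have gu : inv_in Q (ev2 (A c') (B d) g).
  by rewrite QE; apply: local_ring_unit pg; apply: ev_inj.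
exists (f' * hg), (g' * hf); rewrite !rmorphM /= -ef -eg; split.
  by do 2![apply: inv_inM => //].
exact: frac_expand gu.1 uf.1 ug.1.
Qed.

End Point.
(** * The diagonal *)

Local Notation D c := (B c - A c).

(** If z = f / g in lowest terms and a f + b g = 1 then 1 / g = a z + b. *)
Lemma tcoord_frac_unit c (P : set K1) z : subring_set P ->
  (forall f, P (ev1 (tcoord c) f)) -> P z -> exists f g,
  inv_in P (ev1 (tcoord c) g) /\ z = ev1 (tcoord c) f / ev1 (tcoord c) g.
Proof.
move=> sP Pc Pz; have [f [g [g0 zE]]] := tcoord_frac c z.
set d := gcdp f g; pose f' := f %/ d; pose g' := g %/ d.
have fE : f = f' * d by rewrite divpK ?dvdp_gcdl.
have gE : g = g' * d by rewrite divpK ?dvdp_gcdr.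
have gn0 : g != 0 by apply: contraNneq g0 => ->; rewrite rmorph0.
have : coprimep f' g' by rewrite coprimep_div_gcd ?gn0 ?orbT.
move=> /Bezout_eq1_coprimepP[[h1 h2] /= hE].
move: g0; rewrite gE rmorphM mulf_eq0 negb_or => /andP[g'0 d0].
have {}zE : z = ev1 (tcoord c) f' / ev1 (tcoord c) g'.
  by rewrite zE fE gE !rmorphM /= -mulf_div divff ?mulr1.
exists f', g'; split; [split; [exact: g'0|]|exact: zE].
have /(congr1 (ev1 (tcoord c))) := hE; rewrite rmorphD !rmorphM rmorph1 /=.
move=> /(inv_bezout g'0) ->; rewrite -zE.
by apply: subringD => //; apply: subringM.
Qed.

(** The ideal of the diagonal is the unit ideal exactly at the points off the
    diagonal; this criterion does not refer to a chart. *)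
Definition ondiag (Q : set K2) : Prop := P1xP1 Q /\ ~ diag_ideal Q 1.

Lemma tcoordB_neq0 c : D c != 0.
Proof.
rewrite subr_eq0; apply/eqP => AB.
have : ev c 'X = ev c 'X%:P by rewrite ev2_polyX ev2_polyC evp_polyX.
move/ev_inj/eqP; apply/negP/eqP => /(congr1 (size \o polyseq)) /=.
by rewrite size_polyX size_polyC polyX_eq0.
Qed.

Section Chart.
Variables (c : bool) (Q : set K2).
Hypotheses (PQ : P1xP1 Q) (QA : Q (A c)) (QB : Q (B c)).

Let sQ : subring_set Q. Proof. exact: P1xP1_subring. Qed.

Lemma pullp_frac_unit z : projp Q z -> exists f g,
  inv_in Q (pullp (ev1 (tcoord c) g)) /\
  z = ev1 (tcoord c) f / ev1 (tcoord c) g.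
Proof.
move=> Qz; have Qc f : projp Q (ev1 (tcoord c) f) by apply: projp_ev1.
have [f [g [[g0 gu] zE]]] := tcoord_frac_unit (projp_subring PQ) Qc Qz.
by exists f, g; split=> //; split; rewrite ?fmorph_eq0 // -fmorphV.
Qed.

Lemma pullq_frac_unit z : projq Q z -> exists f g,
  inv_in Q (pullq (ev1 (tcoord c) g)) /\
  z = ev1 (tcoord c) f / ev1 (tcoord c) g.
Proof.
move=> Qz; have Qc f : projq Q (ev1 (tcoord c) f) by apply: projq_ev1.
have [f [g [[g0 gu] zE]]] := tcoord_frac_unit (projq_subring PQ) Qc Qz.
by exists f, g; split=> //; split; rewrite ?fmorph_eq0 // -fmorphV.
Qed.

Lemma pullq_diag f : exists h, Q h /\
  pullq (ev1 (tcoord c) f) = pullp (ev1 (tcoord c) f) + D c * h.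
Proof.
have [h hE] := ev_diag c (map_poly polyC f).
exists (ev c h); split; first exact: point_ev.
rewrite pullq_ev1 -(ev2_map (A c)) hE; congr (pullp (ev1 _ _) + _).
exact: comp_polyXr.
Qed.

Lemma subr_coord_in : Q (D c). Proof. exact: subringB. Qed.

(** A function g regular at both projections is a fraction in the coordinate
    whose denominator is a unit at both of them, and u - t divides the
    numerator of g(t) - g(u). *)
Lemma diag_ideal_chart : diag_ideal Q = princ (D c) Q.
Proof.
apply: mspan_princ => //.
  rewrite -opprB -mulN1r; apply: spanM => //.
    by apply: subringN => //; apply: subring1.
  by apply: span_gen => //; exists (tcoord c).
move=> _ [z [zp zq] <-].
have sI : subring_set (projp Q `&` projq Q).
  have [p1 pB pM] := projp_subring PQ; have [q1 qB qM] := projq_subring PQ.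
  by split=> [|x y [px qx] [py qy]|x y [px qx] [py qy]]; split; auto.
have [|f [g [[g0 [gp gq]] zE]]] := tcoord_frac_unit (c := c) sI _ (conj zp zq).
  by move=> f; split; [apply: projp_ev1|apply: projq_ev1].
have [h [Qh hE]] := pullq_diag f; have [h' [Qh' h'E]] := pullq_diag g.
move: gp gq; rewrite /projp /projq /= !fmorphV /= => gp gq.
have pg0 : pullp (ev1 (tcoord c) g) != 0 by rewrite fmorph_eq0.
have qg0 : pullq (ev1 (tcoord c) g) != 0 by rewrite fmorph_eq0.
rewrite zE !fmorph_div /= hE (frac_sub_diag _ _ pg0 qg0 h'E).
have pQ e : Q (pullp (ev1 (tcoord c) e)) by apply: (projp_ev1 PQ).
apply: princP; apply: subringM => //; last exact: subringM.
by apply: subringB => //; apply: subringM.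
Qed.

Lemma ideal_pow_chart j : ideal_pow Q (diag_ideal Q) j = princ (D c ^+ j) Q.
Proof.
elim: j => [|j IH] /=; first by rewrite expr0 princ1.
by rewrite IH diag_ideal_chart setM_princ // exprS.
Qed.

End Chart.
(** The generator x_i^m of O(m) over a chart, written in terms of x_0^m. *)
Definition tgen (c : bool) (m : nat) : K1 := if c then t1 ^+ m else 1.

Lemma tgen_neq0 c m : tgen c m != 0.
Proof. by case: c; rewrite /tgen ?oner_neq0 // expf_neq0 // t1_neq0. Qed.

Lemma twist_stalk_chart c m (P : set K1) : subring_set P -> P (tcoord c) ->
  twist_stalk m P = princ (tgen c m) P.
Proof.
move=> sP Pc; apply: mspan_princ => //.
  by apply: span_gen => //; case: c Pc; [right|left].
move=> z [[Pt ->]|[Pt ->]]; case: c Pc => /= Pc.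
- exists (t1^-1 ^+ m); first exact: subringX.
  by rewrite -exprMn divff ?expr1n ?t1_neq0.
- by exists 1; rewrite ?mulr1 //; apply: subring1.
- by exists 1; rewrite ?mulr1 //; apply: subring1.
- by exists (t1 ^+ m); rewrite ?mul1r //; apply: subringX.
Qed.

Section Chart.
Variables (c : bool) (Q : set K2).
Hypotheses (PQ : P1xP1 Q) (QA : Q (A c)) (QB : Q (B c)).

Let sQ : subring_set Q. Proof. exact: P1xP1_subring. Qed.

Lemma pullq_twist_chart n : pullq_twist n Q = princ (pullq (tgen c n)) Q.
Proof.
rewrite /pullq_twist (twist_stalk_chart n (projq_subring PQ) QB).
apply: mspan_princ => // [|_ [_ [q qQ <-] <-]].
  apply: span_gen => //; exists (tgen c n) => //; exists 1; rewrite ?mulr1 //.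
  by apply: subring1; apply: projq_subring.
by exists (pullq q); rewrite ?rmorphM.
Qed.

Lemma pp_null_chart k n :
  pp_null k n Q = princ (D c ^+ k.+1 * pullq (tgen c n)) Q.
Proof.
rewrite /pp_null (ideal_pow_chart PQ QA QB) pullq_twist_chart setM_princ //.
Qed.

Lemma diag_unit : diag_ideal Q 1 <-> inv_in Q (D c).
Proof. by rewrite (diag_ideal_chart PQ QA QB) princ_unit // tcoordB_neq0. Qed.

End Chart.

Section OnDiag.
Variable Q : set K2.
Hypothesis dQ : ondiag Q.

Let PQ : P1xP1 Q := dQ.1.
Let sQ : subring_set Q. Proof. exact: P1xP1_subring. Qed.
Let lQ : local_set Q. Proof. exact: point_local. Qed.

Let add_nonunit x y : Q x -> Q y -> ~ inv_in Q x -> inv_in Q (1 - x * y).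
Proof.
move=> Qx Qy nx; rewrite -mulrN; apply: local_add => //.
- exact: subring1.
- exact: subringN.
- by split; rewrite ?oner_neq0 // invr1; apply: subring1.
Qed.

(** The only points outside of the squares of the two charts are (0, oo) and
    (oo, 0).  They are off the diagonal since the function 1 / (1 - z) takes
    different values at 0 and oo. *)
Lemma ondiag_chart : exists c, Q (A c) /\ Q (B c).
Proof.
have [c QA] := point_coordp PQ; have [d QB] := point_coordq PQ.
have [QB'|nB] := pselect (Q (B c)); first by exists c.
have [QA'|nA] := pselect (Q (A d)); first by exists d.
have dE : d = ~~ c by move: nA QA; case: (c) (d) => [] [].
subst d; case: dQ => _ []; move: nA QB; rewrite pullp_tcoordN pullq_tcoordN.
move: nB; set x := A c; rewrite -{1}(invrK (B c)); set y := (B c)^-1.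
move=> nB nA Qy.
have y0 : y != 0 by rewrite invr_eq0 pullq_tcoord_neq0.
have nx : ~ inv_in Q x by case.
have ny : ~ inv_in Q y by case.
have Q1 := subring1 sQ.
have [x1 Qx1] : inv_in Q (1 - x) by rewrite -[x]mulr1; apply: add_nonunit.
have [y1 Qy1] : inv_in Q (1 - y) by rewrite -[y]mulr1; apply: add_nonunit.
have [xy1 Qxy1] : inv_in Q (1 - x * y) by apply: add_nonunit.
pose g := (1 - tcoord c)^-1.
have pg : pullp g = (1 - x)^-1 by rewrite fmorphV rmorphB rmorph1.
have qg : pullq g = (1 - y^-1)^-1 by rewrite fmorphV rmorphB rmorph1 invrK.
rewrite (frac_opposite y0 x1 y1 xy1) -pg -qg.
apply: spanM => //; first by do 2!apply: subringM => //; apply: subringB.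
apply: span_gen => //; exists g => //.
split; rewrite /projp /projq /= ?pg ?qg //.
rewrite (inv1B_inv y0); apply: (subringN sQ).
exact: (subringM sQ Qy Qy1).
Qed.

Lemma nonunit_diag c : Q (A c) -> Q (B c) -> ~ inv_in Q (D c).
Proof. by move=> QA QB /(diag_unit PQ QA QB); case: dQ. Qed.

(** If g(t) is a unit then so is g(u), which differs from it by a multiple of
    the non-unit u - t; hence the denominators allowed at the two projections
    are the same. *)
Lemma ondiag_proj : projp Q = projq Q.
Proof.
have [c [QA QB]] := ondiag_chart; have nD := nonunit_diag QA QB.
have QD := subr_coord_in PQ QA QB.
have pQ f : Q (pullp (ev1 (tcoord c) f)) by apply: (projp_ev1 PQ).
have qQ f : Q (pullq (ev1 (tcoord c) f)) by apply: (projq_ev1 PQ).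
apply/seteqP; split=> z.
  move=> /(pullp_frac_unit PQ QA)[f [g [gu ->]]].
  have [h [Qh hE]] := pullq_diag PQ QA QB g.
  have : inv_in Q (pullq (ev1 (tcoord c) g)) by rewrite hE; apply: local_add.
  by case=> _ gu'; rewrite /projq /= fmorph_div /=; apply: subringM.
move=> /(pullq_frac_unit PQ QB)[f [g [gu ->]]].
have [h [Qh hE]] := pullq_diag PQ QA QB g.
have : inv_in Q (pullp (ev1 (tcoord c) g)).
  have -> : pullp (ev1 (tcoord c) g) = pullq (ev1 (tcoord c) g) + D c * (- h).
    by rewrite hE mulrN addrK.
  by apply: local_add => //; apply: subringN.
by case=> _ gu'; rewrite /projp /= fmorph_div /=; apply: subringM.
Qed.

Lemma ondiag_tcoord c : Q (A c) -> Q (B c).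
Proof.
by change (projp Q (tcoord c) -> projq Q (tcoord c)); rewrite ondiag_proj.
Qed.

(** Write z = f / g with g a unit.  Setting u := t changes f and g by multiples
    of u - t, which is not a unit, so that g(t, t) is still a unit. *)
Lemma diag_residue c z : Q (A c) -> Q z ->
  exists y q, [/\ projp Q y, Q q & z = pullp y + D c * q].
Proof.
move=> QA; have QB := ondiag_tcoord QA => Qz.
have nD := nonunit_diag QA QB; have QD := subr_coord_in PQ QA QB.
have [f [g [gu zE]]] := chart_frac PQ QA QB Qz.
have Qe e : Q (ev c e) by apply: point_ev.
have pe e : Q (pullp (ev1 (tcoord c) e)) by apply: (projp_ev1 PQ).
have [h hE] := ev_diag c f; have [h' h'E] := ev_diag c g.
have gE : pullp (ev1 (tcoord c) g.['X]) = ev c g + D c * (- ev c h').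
  by rewrite h'E mulrN addrK.
have [g0 gu'] : inv_in Q (pullp (ev1 (tcoord c) g.['X])).
  by rewrite gE; apply: local_add => //; apply: subringN.
exists (ev1 (tcoord c) f.['X] / ev1 (tcoord c) g.['X]).
exists (- ((pullp (ev1 (tcoord c) f.['X]) * ev c h' -
   ev c h * pullp (ev1 (tcoord c) g.['X])) *
   ((pullp (ev1 (tcoord c) g.['X]))^-1 * (ev c g)^-1))); split.
- by rewrite /projp /= fmorph_div /=; apply: subringM.
- apply: subringN => //; apply: subringM => //; last first.
    by apply: subringM => //; apply: gu.2.
  by apply: subringB => //; apply: subringM.
- rewrite mulrN fmorph_div /= -(frac_sub_diag _ _ g0 gu.1 h'E) -hE zE.
  by rewrite opprB addrC subrK.
Qed.

(** Iterating [diag_residue] gives the expansion in powers of u - t, with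
    coefficients regular at the first projection. *)
Lemma diag_taylor c m z : Q (A c) -> Q z -> exists y q,
  [/\ forall l : nat, projp Q (y l), Q q &
    z = \sum_(l < m) pullp (y l) * D c ^+ l + D c ^+ m * q].
Proof.
move=> QA; elim: m z => [|m IH] z Qz.
  exists (fun=> 0), z; split=> // [l|].
    by apply: subring0; apply: projp_subring.
  by rewrite big_ord0 add0r expr0 mul1r.
have [y0 [z' [y0Q z'Q ->]]] := diag_residue QA Qz.
have [y [q [yQ qQ ->]]] := IH _ z'Q.
exists (fun l => if l is l'.+1 then y l' else y0), q; split=> // [[|l]//|].
rewrite big_ord_recl expr0 mulr1 -addrA mulrDr mulr_sumr exprS mulrA.
by congr (_ + (_ + _)); apply: eq_bigr => l _; rewrite exprS mulrCA.
Qed.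

End OnDiag.

Lemma diag_point P : P1 P -> exists2 Q, ondiag Q & projp Q = P.
Proof.
move=> /P1P[c [p PE]]; set p' := (diag_pred p : prime_idealr _).
set Q := local_ring (ev c) p'.
have PQ : P1xP1 Q by apply/P1xP1P; exists c, c, p'.
have QA : Q (A c) by apply: local_ring2_p.
have QB : Q (B c) by apply: local_ring2_q.
exists Q.
  split=> //; rewrite (diag_unit PQ QA QB).
  rewrite -(ev2_sub (A c) (B c)).
  move=> /(local_ring_inv (@ev_inj c c)).
  by rewrite /p' /in_mem /= /diag_pred !hornerE subrr rpred0.
apply/seteqP; split=> z.
  move=> /(pullp_frac_unit PQ QA)[f [g [gu ->]]].
  rewrite PE; exists f, g; split=> //.
  move: gu; rewrite pullp_ev1 -(ev2_polyC _ (B c)).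
  move=> /(local_ring_inv (@ev_inj c c)).
  by rewrite /p' /in_mem /= /diag_pred hornerC.
rewrite PE => -[f [g [pg ->]]]; exists f%:P, g%:P; split.
  by rewrite /p' /in_mem /= /diag_pred hornerC.
by rewrite fmorph_div /= !pullp_ev1 !ev2_polyC.
Qed.

Section Generic.
Variable G : set K2.
Hypotheses (dG : ondiag G) (pG : projp G = setT).

Let PG : P1xP1 G := dG.1.
Let sG : subring_set G. Proof. exact: P1xP1_subring. Qed.

Lemma generic_p z : G (pullp z).
Proof. by change (projp G z); rewrite pG. Qed.
Lemma generic_q z : G (pullq z).
Proof. by change (projq G z); rewrite -(ondiag_proj dG) pG. Qed.

Let nonunit c : ~ inv_in G (D c).
Proof. by apply: nonunit_diag => //; [apply: generic_p|apply: generic_q]. Qed.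

(** A unit g at Q is not divisible by u - t, so that g(t, t) is not zero and g
    is invertible at the generic point of the diagonal. *)
Lemma ondiag_generic Q : ondiag Q -> Q `<=` G.
Proof.
move=> dQ z Qz; have PQ := dQ.1; have [c [QA QB]] := ondiag_chart dQ.
have sQ := P1xP1_subring PQ.
have [f [g [gu ->]]] := chart_frac PQ QA QB Qz.
have GA := generic_p (tcoord c); have GB := generic_q (tcoord c).
have Ge e : G (ev c e) by apply: point_ev.
apply: subringM => //.
have [h hE] := ev_diag c g; rewrite hE.
have [g0|g0] := eqVneq (ev1 (tcoord c) g.['X]) 0.
  case: (nonunit_diag dQ QA QB); move: gu; rewrite hE g0 rmorph0 add0r.
  by apply: inv_in_factor => //; [apply: subr_coord_in|apply: point_ev].
suff [] : inv_in G (pullp (ev1 (tcoord c) g.['X]) + D c * ev c h) by [].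
apply: local_add => //.
- exact: point_local.
- exact: generic_p.
- exact: subringB.
- by split; rewrite ?fmorph_eq0 // -fmorphV; apply: generic_p.
Qed.

(** The coefficient of order 0 is a multiple of u - t, hence not a unit at the
    generic point of the diagonal; as it is a function of t, it is zero.  The
    next coefficients follow after division by u - t. *)
Lemma generic_indep c m (y : nat -> K1) :
  princ (D c ^+ m) G (\sum_(l < m) pullp (y l) * D c ^+ l) ->
  forall l, (l < m)%N -> y l = 0.
Proof.
elim: m y => [//|m IH] y [q Gq].
have GD : G (D c) by apply: subringB => //; [apply: generic_q|apply: generic_p].
rewrite big_ord_recl expr0 mulr1 exprS.
under eq_bigr do rewrite exprS mulrCA.
rewrite -mulr_sumr -mulrA; set s := \sum_(i < m) _ => e.
have Gs : G s.
  apply: subring_sum => // i _; apply: subringM => //; first exact: generic_p.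
  exact: subringX.
have y0 : y 0%N = 0.
  apply/eqP/negP => /negP y0; case: (nonunit (c := c)).
  apply: (@inv_in_factor _ _ sG _ (D c ^+ m * q - s)) => //.
    by apply: subringB => //; apply: subringM => //; apply: subringX.
  rewrite mulrBr e addrK.
  by split; rewrite ?fmorph_eq0 // -fmorphV; apply: generic_p.
move: e; rewrite y0 rmorph0 add0r => /(mulfI (tcoordB_neq0 c)) e.
move=> [//|l]; rewrite ltnS; apply: (IH (fun l => y l.+1)).
by exists q.
Qed.

End Generic.
End Points.

(** * Sections and maps of sheaves *)

Lemma zariski_nbhd_self (E : fieldType) (X : set (set E)) P U :
  X P -> zariski_nbhd X P U -> U P.
Proof. by move=> XP [s [sP]]; apply. Qed.

Lemma mem3 (T : eqType) (x y z : T) :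
  [/\ x \in [:: x; y; z], y \in [:: x; y; z] & z \in [:: x; y; z]].
Proof. by split; rewrite !inE eqxx ?orbT. Qed.

Section Sheaf.
Variables (F : fieldType) (k n m : nat).
Local Notation K1 := (K1 F).
Local Notation K2 := (K2 F).
Local Notation t1 := (t1 F).
Local Notation P1 := (@P1 F).
Local Notation P1xP1 := (@P1xP1 F).
Local Notation tcoord := (tcoord F).
Local Notation A c := (pullp (tcoord c)).
Local Notation B c := (pullq (tcoord c)).
Local Notation D c := (B c - A c).
Local Notation tgen := (tgen F).
Local Notation null := (pp_null k n).

Lemma nullB Q y z : P1xP1 Q -> null Q y -> null Q z -> null Q (y - z).
Proof. by move=> PQ; apply: spanB; apply: P1xP1_subring. Qed.

Lemma null0 Q : null Q (0 : K2). Proof. exact: span0. Qed.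

Lemma null_sum Q (I : Type) (r : seq I) (f : I -> K2) : P1xP1 Q ->
  (forall i, null Q (f i)) -> null Q (\sum_(i <- r) f i).
Proof.
move=> PQ H; apply: (big_ind (null Q)) => // [|x y]; first exact: null0.
exact: pp_nullD.
Qed.

Lemma null_trans Q x y z : P1xP1 Q ->
  null Q (x - y) -> null Q (y - z) -> null Q (x - z).
Proof. by move=> PQ Nx Ny; rewrite -(subrK y x) -addrA; apply: pp_nullD. Qed.

Lemma null_sym Q x y : P1xP1 Q -> null Q (x - y) -> null Q (y - x).
Proof.
by move=> PQ N; rewrite -opprB -sub0r; apply: nullB => //; apply: null0.
Qed.

(** * Away from the diagonal *)

Lemma offdiag_null Q z : P1xP1 Q -> diag_ideal Q 1 -> pullq_twist n Q z ->
  null Q z.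
Proof.
move=> PQ I1 Tz; have sQ := P1xP1_subring PQ.
have pow1 j : ideal_pow Q (diag_ideal Q) j 1.
  elim: j => [|j IH]; first exact: subring1.
  by apply: (span_gen sQ); exists 1 => //; exists 1; rewrite ?mulr1.
by apply: (span_gen sQ); exists 1; [exact: pow1|exists z; rewrite ?mul1r].
Qed.

(** That 1 belongs to the ideal of the diagonal is expressed by finitely many
    regular functions. *)
Lemma offdiag_open Q : P1xP1 Q -> diag_ideal Q 1 ->
  zariski_nbhd P1xP1 Q [set Q' | diag_ideal Q' 1].
Proof.
move=> PQ; move: (1 : K2).
pose T z := zariski_nbhd P1xP1 Q [set Q' | diag_ideal Q' z].
apply: (mspan_sub (T := T)); rewrite /T.
- by exists [::]; split=> // Q' PQ' _; apply: span0.
- move=> x y Tx Ty; apply: zariski_nbhdS (zariski_nbhdI Tx Ty) => Q' PQ' [].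
  exact/mspanD/P1xP1_subring.
move=> a _ Qa [g [gp gq] <-]; exists [:: a; pullp g; pullq g]; split.
  by move=> f; rewrite !inE => /or3P[] /eqP ->.
move=> Q' PQ' H; have sQ' := P1xP1_subring PQ'.
apply: (spanM sQ'); first by apply: H; rewrite inE eqxx.
apply: (span_gen sQ'); exists g => //.
by split; apply: H; rewrite !inE eqxx ?orbT.
Qed.

Lemma sec_offdiag (U : opens F) (s : pp_lift k n U) Q :
  P1xP1 Q -> opset U (projp Q) -> diag_ideal Q 1 -> null Q (s Q).
Proof.
move=> PQ UQ I1; have [z nz] := pp_liftP s PQ UQ.
have [Tz Nz] := zariski_nbhd_self PQ nz UQ.
by rewrite -(subrK z (s Q)); apply: pp_nullD => //; apply: offdiag_null.
Qed.

(** Off the diagonal, where the ideal of the diagonal is the unit ideal, every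
    germ of O/I^(k+1) vanishes. *)
Lemma pp_eq_ondiag (U : opens F) (s s' : pp_sec k n U) :
  (forall Q, ondiag Q -> opset U (projp Q) -> null Q (repr s Q - repr s' Q)) ->
  s = s'.
Proof.
move=> H; rewrite -[s]reprK -[s']reprK; apply/pp_secP => Q PQ UQ.
have [I1|nI] := pselect (diag_ideal Q 1); last exact: H.
by apply: nullB => //; apply: sec_offdiag.
Qed.

Lemma repr_sum (U : opens F) (I : Type) (r : seq I) (s : I -> pp_sec k n U) Q :
  P1xP1 Q -> opset U (projp Q) ->
  null Q (repr (\sum_(i <- r) s i) Q - \sum_(i <- r) repr (s i) Q).
Proof.
move=> PQ UQ; have -> : \sum_(i <- r) s i =
    \pi_(pp_sec k n U) (\sum_(i <- r) repr (s i)).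
  rewrite (big_morph _ (@pi_ppD F k n U) (erefl _)).
  have -> : \pi_(pp_sec k n U) (0 : pp_lift k n U) = 0.
    by rewrite -{1}(subrr 0) pi_ppB subrr.
  by apply: eq_bigr => i _; rewrite reprK.
have -> : \sum_(i <- r) repr (s i) Q =
    (\sum_(i <- r) repr (s i) : pp_lift k n U) Q.
  by elim/big_rec2: _ => // i x y _ ->.
exact: repr_pi.
Qed.

Definition xpow (c : bool) : twist F m (chart (tcoord c)) :=
  if c return twist F m (chart (tcoord c)) then x1pow F m else x0pow F m.

Lemma val_xpow c : val (xpow c) = tgen c m.
Proof. by case: c. Qed.

Lemma twist_coord (U : opens F) (s : twist F m U) c P :
  opset U P -> P (tcoord c) -> P (val s / tgen c m).
Proof.
move=> UP Pc; have := twist_stalkP s UP.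
rewrite (twist_stalk_chart m (opens_subring UP) Pc) => -[q Pq <-].
by rewrite mulrC mulKf ?tgen_neq0.
Qed.

(** * Maps given by local formulas *)

(** Over the intersection of U with a chart, s is a multiple of the generator
    x_i^m, and phi is linear and commutes with restrictions. *)
Lemma hom_local (phi : OXhom (twist F m) (principal_parts F k n)) c w
    (U : opens F) (s : twist F m U) Q :
  pp_given (phi _ (xpow c)) w -> ondiag Q -> opset U (projp Q) -> Q (A c) ->
  null Q (repr (phi U s) Q - pullp (val s / tgen c m) * w).
Proof.
move=> phiw dQ UQ QA; have PQ := dQ.1.
pose V := opensI U (chart (tcoord c)).
have aV : val s / tgen c m \in OX_pred V.
  by apply/asboolP => P [UP [_ Pc]]; apply: twist_coord.
pose a : OX V := MkOX aV.
have e : res (@opensIl _ U (chart (tcoord c))) s =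
    a *: res (@opensIr _ U (chart (tcoord c))) (xpow c).
  by apply: val_inj; rewrite /= val_xpow divfK ?tgen_neq0.
have := congr1 (phi V) e; rewrite linearZ /= !hom_res => /= {}e.
have CQ : opset (chart (tcoord c)) (projp Q).
  by split=> //; apply: (opens_open U).1.
have CQ' : opset (chart (tcoord c)) (projq Q) by rewrite -(ondiag_proj dQ).
have : null Q (repr (phi U s) Q - pullp (val a) * repr (phi _ (xpow c)) Q).
  have e' : pp_res (@opensIl _ U (chart (tcoord c))) (phi U s) =
    pp_scale a (pp_res (@opensIr _ U (chart (tcoord c))) (phi _ (xpow c))) := e.
  move: e'; rewrite /pp_res pi_scale => /pp_secP; apply=> //.
move/null_trans; apply=> //; rewrite -mulrBr.
by apply: pp_nullM => //; [exact: (twist_coord s UQ QA)|apply: phiw].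
Qed.

Section MkHom.
Variable w : bool -> K2.
Hypothesis w_twist : forall c Q, P1xP1 Q -> Q (A c) -> Q (B c) ->
  pullq_twist n Q (w c).
Hypothesis w_compat : forall Q, ondiag Q -> Q (A false) -> Q (A true) ->
  null Q (pullp (tgen true m) * w false - w true).

(** The image of x x_0^m.  At the points of the diagonal in both charts the two
    formulas agree modulo I^(k+1); off the diagonal every value represents
    zero. *)
Definition hom_val (x : K1) (Q : set K2) : K2 :=
  if `[< diag_ideal Q 1 >] then 0
  else if `[< Q (A false) >] then pullp (x / tgen false m) * w false
  else pullp (x / tgen true m) * w true.

Lemma hom_val_chart (U : opens F) (s : twist F m U) c Q : ondiag Q ->
  opset U (projp Q) -> Q (A c) ->
  null Q (hom_val (val s) Q - pullp (val s / tgen c m) * w c).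
Proof.
move=> dQ UQ QA; have [PQ nI] := dQ; rewrite /hom_val.
case: asboolP => // _; case: asboolP => QA0; last first.
  by case: c QA => // _; rewrite subrr; apply: null0.
case: c QA => [QA|_]; last by rewrite subrr; apply: null0.
have -> : val s / tgen false m = val s / tgen true m * tgen true m.
  by rewrite divr1 divfK ?tgen_neq0.
rewrite rmorphM /= -mulrA -mulrBr; apply: pp_nullM => //; last exact: w_compat.
by have := twist_coord s UQ (c := true); apply.
Qed.

(** A formula valid at a point of the diagonal is valid at the points of the
    same chart on which s / x_i^m is regular, be they on the diagonal or not. *)
Lemma hom_lift_subproof (U : opens F) (s : twist F m U) :
  hom_val (val s) \in pp_lift_pred k n U.
Proof.
apply/asboolP => Q PQ UQ; have [I1|nI] := pselect (diag_ideal Q 1).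
  exists 0; apply: zariski_nbhdS (offdiag_open PQ I1) => Q' PQ' I1' _.
  split; first exact: span0.
  by rewrite /hom_val; case: asboolP => // _; rewrite subrr; apply: null0.
have dQ : ondiag Q by [].
have [c [QA QB]] := ondiag_chart dQ.
exists (pullp (val s / tgen c m) * w c).
exists [:: pullp (val s / tgen c m); A c; B c]; split.
  move=> f; rewrite !inE => /or3P[] /eqP -> //.
  by have := twist_coord s UQ (c := c); apply.
move=> Q' PQ' H UQ'.
have [_ /H QA' /H QB'] := mem3 (pullp (val s / tgen c m)) (A c) (B c).
have Tz : pullq_twist n Q' (pullp (val s / tgen c m) * w c).
  apply: (spanM (P1xP1_subring PQ')); last exact: w_twist.
  by have := twist_coord s UQ' (c := c); apply.
split=> //; have [I1|nI'] := pselect (diag_ideal Q' 1); last first.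
  exact: hom_val_chart.
rewrite /hom_val; case: asboolP => // _.
by apply: nullB => //; [exact: null0|exact: offdiag_null].
Qed.

Definition hom_lift (U : opens F) (s : twist F m U) : pp_lift k n U :=
  MkLift (hom_lift_subproof s).

Definition mk_hom_fun (U : opens F) (s : twist F m U) :
    principal_parts F k n U :=
  \pi_(pp_sec k n U) (hom_lift s).

Lemma mk_hom_linear (U : opens F) : linear (@mk_hom_fun U).
Proof.
move=> a s s'; rewrite /mk_hom_fun.
change (\pi_(pp_sec k n U) (hom_lift (a *: s + s')) =
  pp_scale a (\pi_(pp_sec k n U) (hom_lift s)) +
  \pi_(pp_sec k n U) (hom_lift s')).
rewrite pi_scale -pi_ppD.
congr (\pi_(_) _); apply/val_inj/funext => Q /=.
change (hom_val (val a * val s + val s') Q =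
  pullp (val a) * hom_val (val s) Q + hom_val (val s') Q).
have E c : pullp ((val a * val s + val s') / tgen c m) * w c =
  pullp (val a) * (pullp (val s / tgen c m) * w c) +
  pullp (val s' / tgen c m) * w c.
  by rewrite mulrDl rmorphD mulrDl -mulrA rmorphM /= -mulrA.
rewrite /hom_val; case: asboolP => [_|_]; first by rewrite mulr0 addr0.
by case: asboolP => _.
Qed.
HB.instance Definition _ (U : opens F) := GRing.isLinear.Build (OX U)
  (twist F m U) (principal_parts F k n U) _ (@mk_hom_fun U) (@mk_hom_linear U).

Lemma mk_hom_res (U V : opens F) (sVU : V `<=` U) (s : twist F m U) :
  mk_hom_fun (res sVU s) = res sVU (mk_hom_fun s).
Proof.
rewrite [RHS]pi_res; congr (\pi_(_) _); exact/val_inj.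
Qed.

Definition mk_hom : OXhom (twist F m) (principal_parts F k n) :=
  @Defs.Hom F (twist F m) (principal_parts F k n) _ mk_hom_res.

Lemma mk_hom_given c : pp_given (mk_hom _ (xpow c)) (w c).
Proof.
move=> Q PQ UQ UQ'; have QA : Q (A c) := UQ.2; have QB : Q (B c) := UQ'.2.
have [I1|nI] := pselect (diag_ideal Q 1).
  apply: nullB => //; first exact: sec_offdiag.
  by apply: offdiag_null => //; apply: w_twist.
have := repr_pi (hom_lift (xpow c)) PQ UQ.
move/null_trans; apply=> //.
have := @hom_val_chart _ (xpow c) c Q (conj PQ nI) UQ QA.
suff -> : pullp (val (xpow c) / tgen c m) * w c = w c by [].
by rewrite val_xpow divff ?tgen_neq0 // rmorph1 mul1r.
Qed.

End MkHom.
Lemma OXiso_bij (M N : OXmod F) (f : OXhom M N) :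
  (forall U, injective (f U)) -> (forall U s, exists s', f U s' = s) ->
  is_OXiso f.
Proof.
move=> inj surj; pose g U := projT1 (choice (surj U)).
have gK U : cancel (g U) (f U) := projT2 (choice (surj U)).
have Kg U : cancel (f U) (g U) by move=> s; apply: inj; rewrite gK.
have lin U : linear (g U).
  by move=> a s s'; apply: inj; rewrite linearP !gK.
pose gL U : {linear N U -> M U} :=
  HB.pack (g U) (GRing.isLinear.Build (OX U) (N U) (M U) _ (g U) (lin U)).
have gres (U V : opens F) (sVU : V `<=` U) s :
    gL V (res sVU s) = res sVU (gL U s).
  by apply: inj; rewrite hom_res /= !gK.
exists (@Defs.Hom F N M gL gres) => U; split; first exact: Kg.
exact: gK.
Qed.

(** * Frames of the sheaf of principal parts *)

(** The w c i are the local expressions of k+1 sections, with matrix M c with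
    respect to the powers of the equation of the diagonal. *)

Section Frame.
Variables (w : bool -> 'I_k.+1 -> K2) (M : bool -> 'M[{poly F}]_k.+1).
Hypothesis M_unit : forall c, M c \in unitmx.
Hypothesis wE : forall c i, w c i = pullq (tgen c n) *
  \sum_(l < k.+1) pullp (ev1 (tcoord c) (M c i l)) * D c ^+ l.

Let Mev c : 'M[K1]_k.+1 := map_mx (ev1 (tcoord c)) (M c).
Let Nev c : 'M[K1]_k.+1 := map_mx (ev1 (tcoord c)) (invmx (M c)).

Let NM c : Nev c *m Mev c = 1%:M.
Proof.
by rewrite -[LHS](map_mxM (ev1 (tcoord c))) mulVmx ?M_unit // map_mx1.
Qed.
Let MN c : Mev c *m Nev c = 1%:M.
Proof.
by rewrite -[LHS](map_mxM (ev1 (tcoord c))) mulmxV ?M_unit // map_mx1.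
Qed.

Let w_comb c (y : 'rV[K1]_k.+1) :
  \sum_i pullp (y 0 i) * w c i = pullq (tgen c n) *
  \sum_(l < k.+1) pullp ((y *m Mev c) 0 l) * D c ^+ l.
Proof.
under eq_bigr do rewrite wE mulrCA mulr_sumr.
rewrite -mulr_sumr exchange_big /=; congr (_ * _); apply: eq_bigr => l _.
rewrite mxE rmorph_sum mulr_suml; apply: eq_bigr => i _.
by rewrite mxE rmorphM mulrA.
Qed.

(** The Taylor coefficients of z / x_i^n times the inverse matrix, whose entries
    are polynomials in the coordinate, hence regular at the projection of Q. *)
Lemma frame_span c Q z : ondiag Q -> Q (A c) -> pullq_twist n Q z ->
  exists y : 'I_k.+1 -> K1, (forall i, projp Q (y i)) /\
    null Q (z - \sum_i pullp (y i) * w c i).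
Proof.
move=> dQ QA; have PQ := dQ.1; have QB := ondiag_tcoord dQ QA.
have sQ := P1xP1_subring PQ.
rewrite (pullq_twist_chart PQ QB) => -[z' Qz' <-].
have [y [q [Qy Qq ->]]] := diag_taylor dQ k.+1 QA Qz'.
pose Y : 'rV[K1]_k.+1 := \row_l y l.
exists (fun i => (Y *m Nev c) 0 i); split=> [i|].
  have sP := projp_subring PQ.
  rewrite mxE; apply: (subring_sum sP) => l _.
  by rewrite !mxE; apply: (subringM sP) => //; apply: projp_ev1.
rewrite w_comb -mulmxA NM mulmx1.
under [X in _ - _ * X]eq_bigr do rewrite mxE.
rewrite -mulrBr addrAC subrr add0r (pp_null_chart PQ QA QB).
by exists q; rewrite // -mulrA mulrCA.
Qed.

(* G is the generic point of the diagonal. *)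
Variable G : set K2.
Hypotheses (dG : ondiag G) (pG : projp G = setT).

Lemma frame_indep c (y : 'I_k.+1 -> K1) :
  null G (\sum_i pullp (y i) * w c i) -> forall i, y i = 0.
Proof.
have GA := generic_p pG (tcoord c); have GB := generic_q dG pG (tcoord c).
pose Y : 'rV[K1]_k.+1 := \row_i y i.
have -> : \sum_i pullp (y i) * w c i = \sum_i pullp (Y 0 i) * w c i.
  by apply: eq_bigr => i _; rewrite mxE.
rewrite w_comb (pp_null_chart dG.1 GA GB) => -[q Gq e].
have {}e : D c ^+ k.+1 * q =
    \sum_(l < k.+1) pullp ((Y *m Mev c) 0 l) * D c ^+ l.
  have e0 : pullq (tgen c n) != 0 by rewrite fmorph_eq0 tgen_neq0.
  by apply: (mulfI e0); rewrite -e mulrA [pullq _ * _]mulrC.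
have YM : Y *m Mev c = 0.
  apply/rowP => l; rewrite [RHS]mxE.
  have := @generic_indep F G dG pG c k.+1 (fun l => (Y *m Mev c) 0 (inord l)).
  under eq_bigr do rewrite inord_val.
  move=> /(_ _ l (ltn_ord l)); rewrite inord_val; apply.
  by exists q.
have : Y = 0 by rewrite -[Y]mulmx1 -(MN c) mulmxA YM mul0mx.
by move=> /rowP Y0 i; have := Y0 i; rewrite !mxE.
Qed.

Variable phi : 'I_k.+1 -> OXhom (twist F m) (principal_parts F k n).
Hypothesis phiE : forall c i, pp_given (phi i _ (xpow c)) (w c i).

Lemma hom_sum_local (U : opens F) (s : dsum k.+1 (twist F m) U) c Q :
  ondiag Q -> opset U (projp Q) -> Q (A c) ->
  null Q (repr (hom_sum phi U s) Q -
    \sum_i pullp (val (s i) / tgen c m) * w c i).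
Proof.
move=> dQ UQ QA; have PQ := dQ.1.
have e := repr_sum (index_enum _) (fun i => phi i U (s i)) PQ UQ.
apply: (null_trans PQ e).
rewrite -sumrB; apply: null_sum => // i.
exact: hom_local.
Qed.

(* Both terms represent the image of x_0^m, computed in the two charts. *)
Let w_change c i : null G (pullp (tgen c m)^-1 * w c i - w false i).
Proof.
have GA d := generic_p pG (tcoord d).
have UG : opset (chart (tcoord false)) (projp G).
  by rewrite pG; apply: opens_generic.
have H d := hom_local (xpow false) (@phiE d i) dG UG (GA d).
have := null_trans dG.1 (null_sym dG.1 (H c)) (H false).
suff E d : val (xpow false) / tgen d m = (tgen d m)^-1.
  by rewrite !E /tgen invr1 rmorph1 mul1r.
by rewrite val_xpow div1r.
Qed.

Lemma frame_inj (U : opens F) : injective (hom_sum phi U).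
Proof.
apply: raddf_inj => s s0; have UG : opset U (projp G).
  by rewrite pG; apply: opens_generic.
have GA d := generic_p pG (tcoord d).
have := hom_sum_local s (c := false) dG UG (GA _); rewrite s0.
have N0 : null G (repr (0 : pp_sec k n U) G).
  have := repr_sum [::] (fun _ : 'I_0 => 0 : pp_sec k n U) dG.1 UG.
  by rewrite !big_nil subr0.
move=> /(null_sym dG.1) /(pp_nullD dG.1) /(_ N0); rewrite subrK.
move/frame_indep => sE; apply/ffunP => i; rewrite ffunE; apply: val_inj.
by have := sE i; rewrite divr1.
Qed.

(** The coefficients x found at the generic point of the diagonal are the ones
    found at all its points over U, by [frame_indep], since the local rings of
    the latter are contained in that of the former.  Hence they are regular on
    U, as sections of O(m). *)
Lemma frame_surj (U : opens F) (S : principal_parts F k n U) :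
  exists s, hom_sum phi U s = S.
Proof.
have GA d := generic_p pG (tcoord d); have PG := dG.1.
have UG : opset U (projp G) by rewrite pG; apply: opens_generic.
have [z0 nz0] := pp_liftP (repr S) PG UG.
have [Tz0 Nz0] := zariski_nbhd_self PG nz0 UG.
have [x [_ Nx]] := frame_span dG (GA false) Tz0.
have xS := null_trans PG Nz0 Nx.
have loc c Q : ondiag Q -> opset U (projp Q) -> Q (A c) ->
    (forall i, projp Q (x i / tgen c m)) /\
    null Q (repr S Q - \sum_i pullp (x i / tgen c m) * w c i).
  move=> dQ UQ QA; have PQ := dQ.1; have QB := ondiag_tcoord dQ QA.
  have [z nz] := pp_liftP (repr S) PQ UQ.
  have [Tz Nz] := zariski_nbhd_self PQ nz UQ.
  have [y [Qy Ny]] := frame_span dQ QA Tz.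
  suff yE i : y i = x i / tgen c m.
    split=> [i|]; first by rewrite -yE.
    apply: (null_trans PQ Nz).
    suff <- : \sum_i pullp (y i) * w c i =
      \sum_i pullp (x i / tgen c m) * w c i by [].
    by apply: eq_bigr => i _; rewrite yE.
  have sQG := ondiag_generic dG pG dQ.
  have nullQG v : null Q v -> null G v.
    have GB := generic_q dG pG (tcoord c).
    rewrite (pp_null_chart PQ QA QB) (pp_null_chart PG (GA c) GB).
    by move=> [q Qq <-]; apply: princP; apply: sQG.
  have [_ NzG] : pullq_twist n G z /\ null G (repr S G - z).
    by case: nz => f [fQ H]; apply: H => // f' /fQ/sQG.
  have : null G (\sum_i pullp (y i * tgen c m - x i) * w false i).
    have e1 := null_trans PG NzG (nullQG _ Ny).
    have e2 := null_trans PG (null_sym PG e1) xS.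
    have e3 : null G (\sum_i pullp (y i * tgen c m) * w false i -
        \sum_i pullp (y i) * w c i).
      rewrite -sumrB; apply: null_sum => // j.
      rewrite rmorphM /= -mulrA -mulrBr.
      apply: (pp_nullM PG); first exact: generic_p.
      have -> : pullp (tgen c m) * w false j - w c j =
          - pullp (tgen c m) * (pullp (tgen c m)^-1 * w c j - w false j).
        have e0 : pullp (tgen c m) != 0 by rewrite fmorph_eq0 tgen_neq0.
        by rewrite mulrBr fmorphV /= !mulNr opprK mulrA divff // mul1r addrC.
      apply: (pp_nullM PG) (w_change c j).
      by rewrite -rmorphN; apply: generic_p.
    have := null_trans PG e3 e2; rewrite -sumrB.
    by under eq_bigr do rewrite -mulrBl -rmorphB.
  move/frame_indep => /(_ i)/eqP; rewrite subr_eq0 => /eqP <-.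
  by rewrite mulfK ?tgen_neq0.
have xU i : x i \in @twist_pred F m U.
  apply/asboolP => P UP; have PP : P1 P := (opens_open U).1 _ UP.
  have [Q dQ QP] := diag_point PP; have [c [QA _]] := ondiag_chart dQ.
  have UQ : opset U (projp Q) by rewrite QP.
  have [/(_ i) xQ _] := loc c Q dQ UQ QA.
  have Pc : P (tcoord c) by rewrite -QP.
  rewrite (twist_stalk_chart m (opens_subring UP) Pc) -QP.
  by rewrite -(divfK (tgen_neq0 F c m) (x i)) mulrC; apply: princP.
pose s : dsum k.+1 (twist F m) U := [ffun i => MkTwist (xU i) : twist F m U].
have sE i : val (s i) = x i by rewrite ffunE.
exists s; apply: pp_eq_ondiag => Q dQ UQ.
have [c [QA _]] := ondiag_chart dQ; have PQ := dQ.1.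
have [_ /(null_sym PQ)] := loc c Q dQ UQ QA.
apply: (null_trans PQ); have := hom_sum_local s dQ UQ QA.
suff -> : \sum_i pullp (val (s i) / tgen c m) * w c i =
  \sum_i pullp (x i / tgen c m) * w c i by [].
by apply: eq_bigr => i _; rewrite sE.
Qed.

End Frame.
End Sheaf.
(** * The linear systems *)

Lemma sum_ord_widen (V : nmodType) (f : nat -> V) a N : (a <= N)%N ->
  (forall i, (a <= i)%N -> f i = 0) -> \sum_(i < a) f i = \sum_(i < N) f i.
Proof.
move=> aN f0; rewrite (big_ord_widen _ _ aN) big_mkcond /=.
by apply: eq_bigr => i _; case: ltnP => // /f0 ->.
Qed.

Lemma bin_mul_bin N d i :
  ('C(N, d + i) * 'C(d + i, d) = 'C(N, d) * 'C(N - d, i))%N.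
Proof.
have [leN|ltN] := leqP (d + i) N; last first.
  rewrite bin_small // mul0n; have [ltNd|leNd] := ltnP N d.
    by rewrite bin_small // mul0n.
  by rewrite [X in (_ * X)%N]bin_small ?muln0 // ltn_subLR.
have ledN : (d <= N)%N by apply: leq_trans leN; apply: leq_addr.
have f0 : (0 < d`! * i`! * (N - (d + i))`!)%N by rewrite !muln_gt0 !fact_gt0.
apply/eqP; rewrite -(eqn_pmul2r f0); apply/eqP.
have e1 := bin_fact leN; have e2 := bin_fact (leq_addr i d).
have e3 := bin_fact ledN.
have e4 : ('C(N - d, i) * (i`! * (N - d - i)`!) = (N - d)`!)%N.
  by apply: bin_fact; rewrite leq_subRL.
rewrite addKn in e2; rewrite subnDA in e1 *.
transitivity N`!; first by rewrite -e1 -e2; ring.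
by rewrite -e3 -e4; ring.
Qed.

Lemma bin_subE n l j : (j <= n)%N -> (l <= n)%N ->
  Defs.bin_sub n l j = 'C(n - j, n - l).
Proof.
move=> jn ln; rewrite /Defs.bin_sub; case: leqP => [jl|lj]; last first.
  by rewrite bin_small // ltn_sub2l // (leq_trans lj).
by rewrite -bin_sub ?leq_sub2r // subnBA // subnK // (leq_trans jl) .
Qed.

Section Systems.
Variable F : fieldType.

Lemma coef_1DXn m i : ((1 + 'X : {poly F}) ^+ m)`_i = 'C(m, i)%:R.
Proof.
rewrite addrC exprD1n coef_sum.
have [im|mi] := ltnP i m.+1; last first.
  rewrite bin_small // big1 // => j _; rewrite coefMn coefXn.
  by case: eqP (ltn_ord j) => [<-|_ _]; rewrite ?mul0rn // ltnNge mi.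
rewrite (bigD1 (Ordinal im)) //= coefMn coefXn eqxx big1 ?addr0 // => j ji.
by rewrite coefMn coefXn eq_sym (negPf (ji : (j != i :> nat))) mul0rn.
Qed.

(** The left-hand side is the r-th difference of the polynomial C(X, i), which
    has degree i.  The proof compares the coefficients of X^i in
    (1 + X)^(k-r) ((1 + X) - 1)^r. *)
Lemma sum_alt_bin (k r i : nat) : (i <= r <= k)%N ->
  \sum_(j < r.+1) (-1) ^+ j * 'C(r, j)%:R * 'C(k - j, i)%:R = (i == r)%:R :> F.
Proof.
move=> /andP[ir rk].
have e : (1 + 'X : {poly F}) ^+ (k - r) * 'X^r =
    \sum_(j < r.+1) ((-1) ^+ j * 'C(r, j)%:R) *: (1 + 'X) ^+ (k - j).
  have -> : 'X^r = ((1 + 'X) - 1) ^+ r :> {poly F}.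
    by rewrite addrAC subrr add0r.
  rewrite exprBn.
  rewrite mulr_sumr; apply: eq_bigr => j _.
  have -> : (k - j = (k - r) + (r - j))%N by have := ltn_ord j; lia.
  rewrite exprD expr1n mulr1 -mulr_natr -mul_polyC.
  rewrite polyCM polyC_exp polyCN !polyC1.
  by rewrite polyC_natr; ring.
have /(congr1 (fun p : {poly F} => p`_i)) := e.
rewrite coefMXn coef_sum coef_1DXn.
under eq_bigr do rewrite coefZ coef_1DXn.
move=> <-; case: ltngtP ir => // -> _; by rewrite subnn bin0.
Qed.

(** The coefficient of X^r in (1 + X)^(k-a) ((1 + X) - X)^a. *)
Lemma sum_alt_bin_vanish (k a r : nat) : (a <= k)%N -> (r <= k)%N ->
  \sum_(i < r.+1) (-1) ^+ i * 'C(k - i, r - i)%:R * 'C(a, i)%:R =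
  'C(k - a, r)%:R :> F.
Proof.
move=> ak rk.
have e : (1 + 'X : {poly F}) ^+ (k - a) =
    \sum_(i < a.+1) ((-1) ^+ i * 'C(a, i)%:R) *: ((1 + 'X) ^+ (k - i) * 'X^i).
  have {1}-> : (1 + 'X : {poly F}) ^+ (k - a) =
      (1 + 'X) ^+ (k - a) * ((1 + 'X) - 'X) ^+ a.
    by rewrite addrK expr1n mulr1.
  rewrite exprBn.
  rewrite mulr_sumr; apply: eq_bigr => j _.
  have -> : (k - j = (k - a) + (a - j))%N by have := ltn_ord j; lia.
  rewrite exprD -mulr_natr -mul_polyC polyCM polyC_exp polyCN !polyC1.
  by rewrite polyC_natr; ring.
have /(congr1 (fun p : {poly F} => p`_r)) := e.
rewrite coef_sum coef_1DXn => ->.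
under [RHS]eq_bigr do rewrite coefZ coefMXn coef_1DXn.
(* The sum over i <= a and the one over i <= r have the same nonzero terms. *)
pose f i : F := if (r < i)%N then 0
  else (-1) ^+ i * 'C(k - i, r - i)%:R * 'C(a, i)%:R.
transitivity (\sum_(i < r.+1) f i).
  by apply: eq_bigr => i _; rewrite /f ltnNge -ltnS ltn_ord.
rewrite (@sum_ord_widen F f r.+1 k.+1) //; last by move=> i; rewrite /f => ->.
rewrite -(@sum_ord_widen F f a.+1 k.+1) //; last first.
  by move=> i ai; rewrite /f [in 'C(a, i)]bin_small // mulr0; case: ifP.
apply: eq_bigr => i _; rewrite /f; case: ifP => _; first by rewrite mulr0.
by rewrite mulrAC.
Qed.

Hypothesis charF0 : [pchar F] =i pred0.

Lemma bin_neq0 n m : (m <= n)%N -> 'C(n, m)%:R != 0 :> F.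
Proof.
move=> mn; have /pcharf0P -> := charF0.
by rewrite -lt0n bin_gt0.
Qed.

Variables n k : nat.
Hypothesis kn : (k <= n)%N.

(** Up to the factors C(n-k+i, n-k) of the rows and C(n-j, n-k) of the columns,
    which are nonzero in characteristic zero, the matrix of the system has
    entries C(k-j, i), where i = k - l. *)
Lemma phi_coefE r (x : 'I_r.+1 -> F) i : (r <= k)%N -> (i <= k)%N ->
  phi_coef n x (k - i) * 'C(n - k + i, n - k)%:R =
  \sum_(j < r.+1) (-1) ^+ j * ('C(n - j, n - k)%:R * x j) * 'C(k - j, i)%:R.
Proof.
move=> rk ik; rewrite /phi_coef mulr_suml; apply: eq_bigr => j _.
have jr := ltn_ord j.
rewrite bin_subE; [|lia|lia].
have -> : (n - (k - i) = n - k + i)%N by lia.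
have -> : (k - j = n - j - (n - k))%N by lia.
have := congr1 (fun m => m%:R : F) (bin_mul_bin (n - j) (n - k) i).
rewrite !natrM => e.
transitivity ((-1) ^+ j * x j *
  ('C(n - j, n - k + i)%:R * 'C(n - k + i, n - k)%:R)); first by ring.
by rewrite e; ring.
Qed.

Lemma is_solution_exists r : (r <= k)%N -> exists x : 'I_r.+1 -> F,
  is_solution k n x.
Proof.
move=> rk.
(* The weights of the r-th difference, after undoing the scaling of
   [phi_coefE]. *)
exists (fun j => 'C(r, j)%:R * 'C(n - k + r, n - k)%:R / 'C(n - j, n - k)%:R).
set x := (X in is_solution _ _ X).
have xE i : (i <= r)%N ->
    phi_coef n x (k - i) * 'C(n - k + i, n - k)%:R =
    'C(n - k + r, n - k)%:R * (i == r)%:R.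
  move=> ir; rewrite phi_coefE //; last by apply: leq_trans rk.
  rewrite -(@sum_alt_bin k) ?ir ?rk // mulr_sumr; apply: eq_bigr => j _.
  rewrite /x [X in _ * X * _]mulrC divfK; first by ring.
  by apply: bin_neq0; have := ltn_ord j; lia.
split=> [l /andP[kl lk]|].
  have := xE (k - l)%N; rewrite subKn // => /(_ ltac:(lia))/eqP.
  have -> : (k - l == r)%N = false by apply/eqP; lia.
  by rewrite mulr0 mulf_eq0 (negPf (bin_neq0 _)) ?orbF ?leq_addr // => /eqP.
have := xE r (leqnn r); rewrite eqxx mulr1 -[RHS]mul1r.
by apply: mulIf; apply: bin_neq0; apply: leq_addr.
Qed.

(** The combination of the equations with the weights of [sum_alt_bin_vanish]
    has the coefficient C(j, r) at x_j, so it only involves x_r; its right-hand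
    side comes from the last equation and is not zero. *)
Lemma is_solution_top r (x : 'I_r.+1 -> F) : (r <= k)%N -> is_solution k n x ->
  x ord_max != 0.
Proof.
move=> rk [x0 x1]; apply/eqP => xr.
have : \sum_(i < r.+1) (-1) ^+ i * 'C(k - i, r - i)%:R *
    (phi_coef n x (k - i) * 'C(n - k + i, n - k)%:R) = 0.
  have ik (i : 'I_r.+1) : (i <= k)%N by have := ltn_ord i; lia.
  under eq_bigr do rewrite phi_coefE // mulr_sumr.
  rewrite exchange_big big1 //= => j _.
  have jr := ltn_ord j.
  transitivity
    ((-1) ^+ j * ('C(n - j, n - k)%:R * x j) * 'C(k - (k - j), r)%:R).
    rewrite -(@sum_alt_bin_vanish k (k - j) r) //; last by lia.
    by rewrite mulr_sumr; apply: eq_bigr => i _; ring.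
  rewrite subKn; last by lia.
  have [jr'|jr'] := ltnP j r.
    by rewrite [X in _ * X%:R]bin_small // mulr0.
  have -> : j = ord_max by apply: val_inj => /=; lia.
  by rewrite xr !mulr0 mul0r.
rewrite big_ord_recr big1 /= ?add0r => [/eqP|i _]; last first.
  by rewrite x0 ?mul0r ?mulr0 //; have := ltn_ord i; lia.
rewrite x1 mul1r subnn bin0 mulr1 mulf_eq0 signr_eq0 /=.
by apply/negP; apply: bin_neq0; apply: leq_addr.
Qed.

End Systems.
(** * The maps phi_r *)

Section PhiMaps.
Variables (F : fieldType) (n k : nat).
Hypothesis kn : (k <= n)%N.
Local Notation K1 := (K1 F).
Local Notation K2 := (K2 F).
Local Notation t2 := (t2 F).
Local Notation u2 := (u2 F).
Local Notation P1xP1 := (@P1xP1 F).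
Local Notation tcoord := (tcoord F).
Local Notation A c := (pullp (tcoord c)).
Local Notation B c := (pullq (tcoord c)).
Local Notation D c := (B c - A c).
Local Notation tgen := (tgen F).

(** The coefficient of phi_r(x_i^(n-k)) at dt^l (x) x_0^n or, in the chart
    [true], at ds^l (x) x_1^n, as a polynomial in the coordinate t or 1/t. *)
Definition phi_row r (x : 'I_r.+1 -> F) (c : bool) (l : nat) : {poly F} :=
  if c then if (l <= r)%N then x (inord l) *: 'X^(r - l) else 0
  else if (l <= k - r)%N then phi_coef n x l *: 'X^(k - r - l) else 0.

Definition phi_vec r (x : 'I_r.+1 -> F) (c : bool) : K2 := pullq (tgen c n) *
  \sum_(l < k.+1) pullp (ev1 (tcoord c) (phi_row x c l)) * D c ^+ l.

Lemma pullp_ev1Z c (a : F) i :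
  pullp (ev1 (tcoord c) (a *: 'X^i)) = c2 a * A c ^+ i.
Proof.
by rewrite pullp_ev1 -mul_polyC rmorphM rmorphXn /= evp_polyC evp_polyX.
Qed.

Lemma pullp_ev10 c : pullp (ev1 (tcoord c) 0) = 0.
Proof. by rewrite !rmorph0. Qed.

Lemma phi_vec0 r (x : 'I_r.+1 -> F) : phi_vec x false =
  \sum_(l < (k - r).+1)
      c2 (phi_coef n x l) * t2 ^+ (k - r - l) * (u2 - t2) ^+ l.
Proof.
rewrite /phi_vec rmorph1 mul1r pullp_t1 pullq_t1.
pose f l : K2 :=
  pullp (ev1 (tcoord false) (phi_row x false l)) * (u2 - t2) ^+ l.
rewrite -(@sum_ord_widen K2 f (k - r).+1 k.+1); [|by rewrite ltnS leq_subr|].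
  apply: eq_bigr => l _; rewrite /f /phi_row -ltnS ltn_ord.
  by rewrite (pullp_ev1Z false) pullp_tcoord.
by move=> l kl; rewrite /f /phi_row leqNgt kl pullp_ev10 mul0r.
Qed.

Lemma phi_vec1 r (x : 'I_r.+1 -> F) : (r <= k)%N -> phi_vec x true =
  \sum_(j < r.+1)
      c2 (x j) * t2 ^- (r - j) * (u2^-1 - t2^-1) ^+ j * u2 ^+ n.
Proof.
move=> rk; rewrite /phi_vec rmorphXn /= pullq_t1.
have -> : D true = u2^-1 - t2^-1 by rewrite pullp_tcoord pullq_tcoord.
pose f l : K2 := pullp (ev1 (tcoord true) (phi_row x true l)) *
  (u2^-1 - t2^-1) ^+ l.
rewrite -(@sum_ord_widen K2 f r.+1 k.+1) //.
  rewrite mulr_sumr; apply: eq_bigr => l _; rewrite /f /phi_row -ltnS ltn_ord.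
  by rewrite (pullp_ev1Z true) pullp_tcoord inord_val exprVn mulrC.
by move=> l kl; rewrite /f /phi_row leqNgt kl pullp_ev10 mul0r.
Qed.

Lemma is_phiE r (x : 'I_r.+1 -> F)
    (phi : OXhom (twist F (n - k)) (principal_parts F k n)) :
  (r <= k)%N ->
  is_phi x phi <-> forall c, pp_given (phi _ (xpow F (n - k) c)) (phi_vec x c).
Proof.
move=> rk; rewrite /is_phi -phi_vec0 -phi_vec1 //; split=> [[H0 H1] []//|H].
by split; [exact: (H false)|exact: (H true)].
Qed.

(** This makes phi_0 the case r = 0 of the phi_r. *)
Lemma is_phi0E (phi : OXhom (twist F (n - k)) (principal_parts F k n)) :
  is_phi0 phi <-> is_phi (fun _ : 'I_1 => 1) phi.
Proof.
rewrite /is_phi0 /is_phi big_ord1 /= !subn0 !expr0 invr1 rmorph1 !mulr1 mul1r.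
suff -> : \sum_(l < k.+1) 'C(n, l)%:R * t2 ^+ (k - l) * (u2 - t2) ^+ l =
  \sum_(l < k.+1) c2 (phi_coef n (fun _ : 'I_1 => 1) l) * t2 ^+ (k - l) *
    (u2 - t2) ^+ l by [].
apply: eq_bigr => l _; rewrite /phi_coef big_ord1 expr0 mul1r mulr1.
by rewrite /Defs.bin_sub leq0n !subn0 rmorph_nat.
Qed.

Lemma phi_vec_twist r (x : 'I_r.+1 -> F) c Q :
  P1xP1 Q -> Q (A c) -> Q (B c) -> pullq_twist n Q (phi_vec x c).
Proof.
move=> PQ QA QB; have sQ := P1xP1_subring PQ.
rewrite (pullq_twist_chart PQ QB); apply: princP.
apply: (subring_sum sQ) => l _.
apply: (subringM sQ); first exact: (projp_ev1 PQ).
by apply: (subringX sQ); apply: subr_coord_in.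
Qed.

(** On the overlap of the charts the two formulas differ by the terms of order
    l > k - r in u - t; those with l <= k vanish by the linear system, and
    the others are multiples of (u - t)^(k+1). *)
Lemma phi_vec_compat r (x : 'I_r.+1 -> F) Q : (r <= k)%N ->
  (forall l, (k - r < l <= k)%N -> phi_coef n x l = 0) ->
  ondiag Q -> Q (A false) -> Q (A true) ->
  pp_null k n Q (pullp (tgen true (n - k)) * phi_vec x false - phi_vec x true).
Proof.
move=> rk x0 dQ QA QA'; have PQ := dQ.1; have sQ := P1xP1_subring PQ.
have QB := ondiag_tcoord dQ QA.
have Qd : Q (u2 - t2).
  by have := subr_coord_in PQ QA QB; rewrite pullp_tcoord pullq_tcoord.
move: (QA) (QA'); rewrite !pullp_tcoord => Qt Qt'.
pose g l := t2 ^- r * (t2 ^+ (n - l) * (u2 - t2) ^+ l).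
have -> : phi_vec x true = \sum_(l < n.+1) c2 (phi_coef n x l) * g l.
  rewrite phi_vec1 // /phi_coef.
  under [RHS]eq_bigr do rewrite rmorph_sum mulr_suml.
  rewrite exchange_big /=; apply: eq_bigr => j _; rewrite -!mulrA.
  have jr : (j <= r <= n)%N by have := ltn_ord j; lia.
  rewrite [_ * (_ * u2 ^+ n)]mulrA.
  rewrite (inv_diff_expansion (t2_neq0 F) (u2_neq0 F) jr).
  rewrite mulr_sumr; apply: eq_bigr => l _.
  rewrite !rmorphM /= rmorphXn rmorphN rmorph1 rmorph_nat /g.
  by rewrite mulrA; congr (_ * _); rewrite mulrC.
pose f l : K2 := if (l <= k - r)%N then c2 (phi_coef n x l) * g l else 0.
have -> : pullp (tgen true (n - k)) * phi_vec x false = \sum_(l < n.+1) f l.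
  rewrite -(@sum_ord_widen K2 f (k - r).+1 n.+1); [|lia|]; last first.
    by move=> l kl; rewrite /f leqNgt kl.
  rewrite phi_vec0 rmorphXn /= pullp_t1 mulr_sumr; apply: eq_bigr => l _.
  have lk := ltn_ord l; rewrite /f -ltnS lk /g.
  have -> : t2 ^+ (n - l) = t2 ^+ r * (t2 ^+ (n - k) * t2 ^+ (k - r - l)).
    by rewrite -!exprD; congr (_ ^+ _); lia.
  rewrite -!mulrA mulKf ?expf_neq0 ?t2_neq0 // mulrCA.
  by [].
rewrite -sumrB; apply: null_sum => // -[l ln] /=; rewrite /f.
case: leqP => lkr; first by rewrite subrr; apply: null0.
rewrite sub0r; have [lk|lk] := leqP l k.
  by rewrite x0 ?lkr // rmorph0 mul0r oppr0; apply: null0.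
rewrite (pp_null_chart PQ QA QB) rmorph1 mulr1 pullp_t1 pullq_t1.
exists (- (c2 (phi_coef n x l) *
  (t2 ^- r * (t2 ^+ (n - l) * (u2 - t2) ^+ (l - k.+1))))).
  apply: (subringN sQ); apply: (subringM sQ); first exact: point_const.
  apply: (subringM sQ); first by rewrite -exprVn; apply: (subringX sQ).
  by apply: (subringM sQ); apply: (subringX sQ).
have el : (u2 - t2) ^+ l = (u2 - t2) ^+ k.+1 * (u2 - t2) ^+ (l - k.+1).
  by rewrite -exprD subnKC.
rewrite mulrN; congr (- _); rewrite /g el.
by rewrite [LHS]mulrCA [X in _ * X]mulrCA [X in _ * (_ * X)]mulrCA.
Qed.

Lemma phi_exists r (x : 'I_r.+1 -> F) : (r <= k)%N ->
  (forall l, (k - r < l <= k)%N -> phi_coef n x l = 0) ->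
  exists phi : OXhom (twist F (n - k)) (principal_parts F k n), is_phi x phi.
Proof.
move=> rk x0.
exists (mk_hom (@phi_vec_twist r x) (fun Q => @phi_vec_compat r x Q rk x0)).
by apply/is_phiE => // c; apply: mk_hom_given.
Qed.

Lemma trig_unit m (M : 'M[{poly F}]_m) : is_trig_mx M ->
  (forall i, exists2 a : F, a != 0 & M i i = a%:P) -> M \in unitmx.
Proof.
move=> Mt Md; rewrite unitmxE det_trig //; apply: unitr_prod => i _.
have [a a0 ->] := Md i.
by rewrite poly_unitE size_polyC a0 coefC /= unitfE.
Qed.

(** Both matrices are triangular with nonzero constants on the diagonal, the one
    on U_0 after reversing the order of the rows. *)
Lemma phi_row_unit (x : forall r, 'I_r.+1 -> F) c :
  (forall r, (r <= k)%N -> phi_coef n (x r) (k - r) != 0) ->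
  (forall r, (r <= k)%N -> x r ord_max != 0) ->
  (\matrix_(i < k.+1, l < k.+1) phi_row (x i) c l) \in unitmx.
Proof.
move=> xk xr; case: c; last first.
  pose s : 'S_k.+1 := perm (@rev_ord_inj k.+1).
  set M := \matrix_(i, l) _.
  suff : row_perm s M \in unitmx by rewrite row_permE unitmx_mul unitmx_perm.
  have kE (i : 'I_k.+1) : (k - (k.+1 - i.+1) = i)%N by have := ltn_ord i; lia.
  apply: trig_unit => [|i].
    apply/is_trig_mxP => i l il; rewrite !mxE permE /phi_row /= kE.
    by rewrite leqNgt il.
  exists (phi_coef n (x (rev_ord i)) i).
    by have := xk (rev_ord i); rewrite /= kE; apply; rewrite subSS leq_subr.
  by rewrite !mxE permE /phi_row /= kE leqnn subnn expr0 alg_polyC.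
apply: trig_unit => [|i].
  by apply/is_trig_mxP => i l il; rewrite !mxE /phi_row leqNgt il.
exists (x i ord_max); first by rewrite xr // -ltnS.
rewrite !mxE /phi_row leqnn subnn expr0 alg_polyC.
by congr (x i _)%:P; apply: val_inj; rewrite /= inordK.
Qed.

Lemma phi_iso (x : forall r, 'I_r.+1 -> F)
    (phi : 'I_k.+1 -> OXhom (twist F (n - k)) (principal_parts F k n)) :
  (forall r, (r <= k)%N -> phi_coef n (x r) (k - r) != 0) ->
  (forall r, (r <= k)%N -> x r ord_max != 0) ->
  (forall r : 'I_k.+1, is_phi (x r) (phi r)) ->
  is_OXiso (hom_sum phi).
Proof.
move=> xk xr phiE.
have Mu c := phi_row_unit c xk xr.
have [G dG pG] := diag_point (P1_generic F).
have wE c (i : 'I_k.+1) : phi_vec (x i) c = pullq (tgen c n) *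
    \sum_(l < k.+1) pullp (ev1 (tcoord c)
      ((\matrix_(i < k.+1, l < k.+1) phi_row (x i) c l) i l)) * D c ^+ l.
  by rewrite /phi_vec; congr (_ * _); apply: eq_bigr => l _; rewrite mxE.
have phiE' c i : pp_given (phi i _ (xpow F (n - k) c)) (phi_vec (x i) c).
  by move: c; apply/is_phiE; rewrite // -ltnS.
apply: OXiso_bij => U.
  exact: (frame_inj Mu wE dG pG phiE').
exact: (frame_surj Mu wE dG pG phiE').
Qed.

End PhiMaps.

Theorem proposition6p3 (F : fieldType) (n k : nat)
    (charF0 : [pchar F] =i pred0) (k_ge1 : (1 <= k)%N) (k_le_n : (k <= n)%N) :
  [/\ (* the linear systems have solutions *)
      forall r : nat, (1 <= r <= k)%N ->
        exists x : 'I_r.+1 -> F, is_solution k n x,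
      (* the maps phi_r exist *)
      exists phi0 : OXhom (twist F (n - k)) (principal_parts F k n), is_phi0 phi0,
      forall (r : nat) (x : 'I_r.+1 -> F), (1 <= r <= k)%N ->
        is_solution k n x ->
        exists phi : OXhom (twist F (n - k)) (principal_parts F k n),
          is_phi x phi
    & (* their sum is an isomorphism *)
      forall (x : forall r : nat, 'I_r.+1 -> F)
        (phi : 'I_k.+1 -> OXhom (twist F (n - k)) (principal_parts F k n)),
        (forall r : nat, (1 <= r <= k)%N -> is_solution k n (x r)) ->
        is_phi0 (phi ord0) ->
        (forall r : 'I_k.+1, (1 <= r)%N -> is_phi (x r) (phi r)) ->
        is_OXiso (hom_sum phi : OXhom (dsum k.+1 (twist F (n - k)))
                                      (principal_parts F k n))].
Proof.
split.
- by move=> r /andP[_ rk]; apply: is_solution_exists.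
- have [||phi phiE] := @phi_exists F n k k_le_n 0 (fun=> 1) => //.
    by move=> l; rewrite subn0 => /andP[kl]; rewrite leqNgt kl.
  by exists phi; apply/is_phi0E.
- move=> r x /andP[_ rk] [x0 _]; apply: phi_exists => // l.
  by rewrite -addn1; apply: x0.
move=> x phi xsol phi0E phiE.
pose x' r : 'I_r.+1 -> F := if r is 0 then fun=> 1 else x r.
apply: (@phi_iso F n k k_le_n x') => [[|r] rk|[|r] rk|r].
- rewrite /phi_coef big_ord1 expr0 mul1r mulr1 /Defs.bin_sub leq0n !subn0.
  exact: bin_neq0.
- by have [_ ->] := xsol r.+1 rk; rewrite oner_neq0.
- exact: oner_neq0.
- exact: (is_solution_top charF0 k_le_n rk (xsol r.+1 rk)).
have [->|r0] := eqVneq r ord0; first exact/is_phi0E.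
have r1 : (0 < r)%N by rewrite lt0n.
have := phiE r r1; rewrite /x'.
by case: (r : nat) r1.
Qed.
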